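(* Assume (A1)–(A3), and let $\mathcal V_h\subset\mathcal V$ and $\mathcal Q_h\subset\mathcal Q$ be finite dimensional subspaces. Consider the problem of finding $u_h\in H^1(0,T;\mathcal V_h)$, $p_h\in H^1(0,T;\mathcal Q_h)$ such that for $t>0$ $$a(u_h(t),v_h)-b(v_h,p_h(t))=\langle f(t),v_h\rangle\quad\forall v_h\in\mathcal V_h,\qquad(1)$$ $$b(\dot u_h(t),q_h)+k(p_h(t),q_h)=\langle g(t),q_h\rangle\quad\forall q_h\in\mathcal Q_h.\qquad(2)$$ Then (1)–(2) is a regular system of differential-algebraic equations of index $1$. If $b$ is inf-sup stable on $\mathcal V_h\times\mathcal Q_h$, i.e., $$\text{(A3h)}\qquad\sup_{v_h\in\mathcal V_h,\ \|v_h\|_{\mathcal V}=1}b(v_h,q_h)\ge\beta_h\|q_h\|_{\mathcal Q_0}\quad\forall q_h\in\mathcal Q_h\ \text{ with some constant }\beta_h>0,$$ then a unique solution of (1)–(2) exists for any choice of initial values $u_h(0)=u_{h,0}\in\mathcal V_h$ and $p_h(0)=p_{h,0}\in\mathcal Q_h$ satisfying $$a(u_{h,0},v_h)-b(v_h,p_{h,0})=\langle f(0),v_h\rangle\quad\forall v_h\in\mathcal V_h.\qquad(3)$$ If (A3h) is not valid, additional compatibility conditions for $u_{h,0}$ and $p_{h,0}$ are required; that is, (3) alone does not suffice, and there are initial values satisfying (3) for which no solution of (1)–(2) exists.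
   Context: $\mathcal V,\mathcal Q,\mathcal Q_0$ are real Hilbert spaces with compact embedding $\mathcal Q\subset\mathcal Q_0$; identifying $\mathcal Q_0$ with its dual one has a Gelfand triple $\mathcal Q\subset\mathcal Q_0=\mathcal Q_0^*\subset\mathcal Q^*$. $\langle\cdot,\cdot\rangle$ denotes the duality products. The forms $a:\mathcal V\times\mathcal V\to\mathbb R$, $k:\mathcal Q\times\mathcal Q\to\mathbb R$, $b:\mathcal V\times\mathcal Q_0\to\mathbb R$ are bilinear. Assumptions: (A1) $a$ is bounded, elliptic and symmetric. (A2) $k$ is bounded, elliptic and symmetric. (A3) $b$ is bounded and inf-sup stable: there are $C_b,\beta>0$ with $b(v,q)\le C_b\|v\|_{\mathcal V}\|q\|_{\mathcal Q_0}$ and $\sup_{\|v\|_{\mathcal V}=1}b(v,q)\ge\beta\|q\|_{\mathcal Q_0}$ for all $v\in\mathcal V$, $q\in\mathcal Q_0$. One sets $\|v\|_{\mathcal V}^2=a(v,v)$, $\|q\|_{\mathcal Q}^2=k(q,q)$, and the norm of $\mathcal Q_0$ is chosen such that $\|q\|_{\mathcal Q_0}\le\|q\|_{\mathcal Q}$. The data satisfy $f\in H^1(0,T;\mathcal V^* )$, $g\in L^2(0,T;\mathcal Q^* )$. A dot denotes the time derivative. After choosing bases, (1)–(2) is a linear constant coefficient differential-algebraic system $E\dot x+Fx=r(t)$. It is called regular if the matrix pencil $E+\lambda F$ is regular, i.e. $\det(E+\lambda F)$ does not vanish identically in $\lambda$. Its index is the (differentiation) index: the minimal number of times that the equations, or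 some of them, have to be differentiated in time in order to obtain (for sufficiently smooth data) a system of ordinary differential equations for $x$. *)

(* Defs.v *)
From HB Require Import structures.
From mathcomp Require Import all_boot all_order all_algebra sesquilinear.
From mathcomp Require Import all_classical all_reals all_analysis.

Set Implicit Arguments.
Unset Strict Implicit.
Unset Printing Implicit Defensive.
Import Order.TTheory GRing.Theory Num.Theory.
Import numFieldNormedType.Exports.
Local Open Scope classical_set_scope.
Local Open Scope ring_scope.

Section Dual.
Context {R : realType} {X : normedModType R}.

Definition bounded_functional (f : X -> R^o) : Prop :=
  linear f /\ exists C : R, forall x, `|f x| <= C * `|x|.

Definition bounded_functional_pred : {pred X -> R^o} :=
  fun f => `[< bounded_functional f >].

Lemma bounded_functional_submod : submod_closed bounded_functional_pred.
Proof.
split.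
  apply/asboolP; split; last by exists 0 => x; rewrite normr0 mul0r.
  by move=> c x y; rewrite [RHS]addr0 scaler0.
move=> c f g /asboolP[lf [Cf hf]] /asboolP[lg [Cg hg]]; apply/asboolP; split.
  move=> d x y.
  change (c *: f (d *: x + y) + g (d *: x + y) =
    d *: (c *: f x + g x) + (c *: f y + g y)).
  rewrite lf lg !scalerDr !scalerA (mulrC c d) -!addrA; congr (_ + _).
  by rewrite addrCA.
exists (`|c| * Cf + Cg) => x.
change (`|c *: f x + g x| <= (`|c| * Cf + Cg) * `|x|).
rewrite (le_trans (ler_normD _ _))// mulrDl lerD ?hg// normrZ -mulrA.
exact: ler_wpM2l.
Qed.

HB.instance Definition _ := GRing.isSubmodClosed.Build R (X -> R^o)
  bounded_functional_pred bounded_functional_submod.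

End Dual.

Record dual {R : realType} (X : normedModType R) := Dual {
  dual_fun :> X -> R^o;
  _ : dual_fun \in @bounded_functional_pred R X }.

Section DualNorm.
Context {R : realType} {X : normedModType R}.

HB.instance Definition _ := [isSub of dual X for @dual_fun R X].
HB.instance Definition _ := [Choice of dual X by <:].
HB.instance Definition _ := [SubChoice_isSubLmodule of dual X by <:].

Implicit Types f g : dual X.

Lemma dual_bounded f : exists C : R, forall x, `|f x| <= C * `|x|.
Proof. by case: f => f /= /asboolP[]. Qed.

Lemma dual_linear f : linear f.
Proof. by case: f => f /= /asboolP[]. Qed.

Definition dual_values f : set R := [set `|f x| | x in [set x : X | `|x| <= 1]].

Definition dual_norm f : R := sup (dual_values f).

Lemma dual_values_has_sup f : has_sup (dual_values f).
Proof.
split; first by exists `|f 0|, 0 => //=; rewrite normr0 ler01.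
have [C hC] := dual_bounded f; exists `|C| => _ [x /= x1 <-].
rewrite (le_trans (hC x))// (le_trans (ler_wpM2r _ (ler_norm C)))//.
by rewrite -[leRHS]mulr1 ler_wpM2l.
Qed.

Lemma dual_norm_ub f x : `|x| <= 1 -> `|f x| <= dual_norm f.
Proof.
move=> x1; apply: ub_le_sup; first by have [] := dual_values_has_sup f.
by exists x.
Qed.

Lemma dual_norm_le f (C : R) :
  (forall x, `|x| <= 1 -> `|f x| <= C) -> dual_norm f <= C.
Proof.
move=> h; apply: ge_sup; first by have [] := dual_values_has_sup f.
by move=> _ [x x1 <-]; exact: h.
Qed.

Lemma dual_normD f g : dual_norm (f + g) <= dual_norm f + dual_norm g.
Proof.
apply: dual_norm_le => x x1; change (`|f x + g x| <= dual_norm f + dual_norm g).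
by rewrite (le_trans (ler_normD _ _))// lerD// dual_norm_ub.
Qed.

Lemma dual_normZ_le (c : R) f : dual_norm (c *: f) <= `|c| * dual_norm f.
Proof.
apply: dual_norm_le => x x1; change (`|c *: f x| <= `|c| * dual_norm f).
by rewrite normrZ ler_wpM2l// dual_norm_ub.
Qed.

Lemma dual_normZ (c : R) f : dual_norm (c *: f) = `|c| * dual_norm f.
Proof.
apply/eqP; rewrite eq_le dual_normZ_le/=.
have [->|c0] := eqVneq c 0.
  rewrite normr0 mul0r (le_trans (normr_ge0 ((0 *: f : dual X) 0)))//.
  by rewrite dual_norm_ub// normr0.
rewrite -ler_pdivlMl ?normr_gt0// -normfV.
by rewrite -[X in dual_norm X <= _](scalerK c0) dual_normZ_le.
Qed.

Lemma dual_norm0_eq0 f : dual_norm f = 0 -> f = 0.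
Proof.
move=> f0; apply/val_inj/funext => x; change (f x = 0).
have f00 : f 0 = 0.
  have := dual_linear f 1 0 0; rewrite !scale1r addr0 => /eqP.
  by rewrite -subr_eq0 opprD addNKr oppr_eq0 => /eqP.
have [->//|x0] := eqVneq x 0.
have nx0 : `|x| != 0 by rewrite normr_eq0.
have := @dual_norm_ub f (`|x|^-1 *: x).
rewrite normrZ normfV normr_id mulVf// lexx => /(_ isT).
rewrite f0 normr_le0 -[_ *: x]addr0 dual_linear f00 addr0.
by rewrite scaler_eq0 invr_eq0 (negbTE nx0) => /eqP.
Qed.

HB.instance Definition _ :=
  Lmodule_isNormed.Build R (dual X) dual_normD dual_normZ dual_norm0_eq0.

End DualNorm.

Section Bochner.
Context {R : realType}.
Local Notation mu := (@lebesgue_measure R).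

Definition simple_function {X : normedModType R} (s : R -> X) : Prop :=
  finite_set (range s) /\ forall x, measurable (s @^-1` [set x]).

Definition strongly_measurable {X : normedModType R} (D : set R) (u : R -> X) :
    Prop :=
  exists s : nat -> R -> X, (forall n, simple_function (s n)) /\
    forall t, D t -> s n t @[n --> \oo] --> u t.

(* u represents an element of L^2(0,T;X); strong measurability is required
   everywhere on (0,T), which every a.e. class satisfies for some
   representative. *)
Definition bochner_L2 {X : normedModType R} (T : R) (u : R -> X) : Prop :=
  strongly_measurable `]0, T[ u /\
  (\int[mu]_(t in `]0%R, T[) (`|u t| ^+ 2)%:E < +oo)%E.

(* C^1_c(0,T) *)
Definition test_function (T : R) (phi : R -> R) : Prop :=
  [/\ forall t, derivable phi t 1, continuous (derive1 phi) &
    exists c d : R, [/\ 0 < c, d < T &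
      forall t, t \notin `[c, d] -> phi t = 0]].

(* The identity of X-valued integrals
     \int_0^T phi' u = - \int_0^T phi u'
   is stated after applying an arbitrary functional l of X^*: this is
   equivalent since l commutes with the Bochner integral and X^* separates the
   points of X. *)
Definition weak_derivative {X : normedModType R} (T : R) (u du : R -> X) :
    Prop :=
  forall (l : dual X) (phi : R -> R), test_function T phi ->
    \int[mu]_(t in `]0, T[) (derive1 phi t * l (u t)) =
    - \int[mu]_(t in `]0, T[) (phi t * l (du t)).

(* u is the continuous representative on [0,T] of an element of H^1(0,T;S),
   S a subspace of X, and du represents its derivative. Choosing the continuous
   representative gives a meaning to u(0). *)
Definition H1_with_derivative {X : normedModType R} (T : R) (S : set X)
    (u du : R -> X) : Prop :=
  [/\ {within `[0, T], continuous u},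
      forall t, t \in `[0, T] -> S (u t),
      forall t, t \in `]0, T[ -> S (du t),
      bochner_L2 T u /\ bochner_L2 T du &
      weak_derivative T u du].

End Bochner.

Section Forms.
Context {R : realType}.

Definition hilbert (X : completeNormedModType R) : Prop :=
  exists ip : {dot X for idfun}, forall x : X, `|x| ^+ 2 = ip x x.

Definition bounded_elliptic_symmetric {X : normedModType R}
    (c : {bilinear X -> X -> R | *%R & *%R}) : Prop :=
  [/\ exists C : R, forall x y, `|c x y| <= C * `|x| * `|y|,
      exists2 alpha : R, 0 < alpha & forall x, alpha * `|x| ^+ 2 <= c x x &
      forall x y, c x y = c y x].

Definition energy_norm {X : normedModType R}
    (c : {bilinear X -> X -> R | *%R & *%R}) (x : X) : R :=
  Num.sqrt (c x x).

(* Compact dense embedding Q -> Q0; density is what makes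
   Q0 = Q0^* -> Q^* injective in the Gelfand triple. *)
Definition compact_dense_embedding {Q Q0 : normedModType R}
    (emb : {linear Q -> Q0}) : Prop :=
  [/\ injective emb, dense (range emb) &
      precompact (emb @` [set q : Q | `|q| <= 1])].

Definition bounded_form {V Q0 : normedModType R}
    (a : {bilinear V -> V -> R | *%R & *%R})
    (b : {bilinear V -> Q0 -> R | *%R & *%R}) : Prop :=
  exists2 Cb : R, 0 < Cb & forall v q, b v q <= Cb * energy_norm a v * `|q|.

(* For A = {0} the supremum is over the empty set and equals 0. *)
Definition infsup_stable {V Q0 : normedModType R}
    (a : {bilinear V -> V -> R | *%R & *%R})
    (b : {bilinear V -> Q0 -> R | *%R & *%R}) (A : set V) (B : set Q0) : Prop :=
  exists2 beta : R, 0 < beta & forall q, B q ->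
    beta * `|q| <= sup [set b v q | v in A `&` [set v | energy_norm a v = 1]].

Definition is_basis {X : normedModType R} (S : set X) n (e : 'I_n -> X) :
    Prop :=
  (forall x, S x <-> exists c : 'I_n -> R, x = \sum_i c i *: e i) /\
  (forall c : 'I_n -> R, \sum_i c i *: e i = 0 -> forall i, c i = 0).

Definition fin_dim_subspace {X : normedModType R} (S : set X) : Prop :=
  exists n (e : 'I_n -> X), is_basis S e.

End Forms.

(* The linear constant coefficient system E x' + F x = r. *)
Section DAE.
Context {R : realType} {N : nat}.
Implicit Types E F : 'M[R]_N.

Definition regular_pencil E F : Prop :=
  exists lambda : R, \det (E + lambda *: F) != 0.

(* x j stands for the j-th derivative of the unknown at a fixed time. The i-th
   derivative of the system is E x_{i+1} + F x_i = r^{(i)}; the condition says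
   that some linear combination of the derivatives of order <= k is the system
   of ordinary differential equations x' + C x = \sum_i G_i r^{(i)}. *)
Definition ode_after_differentiations E F (k : nat) : Prop :=
  exists (G : 'I_k.+1 -> 'M[R]_N) (C : 'M[R]_N), forall x : nat -> 'cV[R]_N,
    \sum_(i < k.+1) G i *m (E *m x i.+1 + F *m x i) = x 1%N + C *m x 0%N.

Definition differentiation_index E F (k : nat) : Prop :=
  ode_after_differentiations E F k /\
  forall j, (j < k)%N -> ~ ode_after_differentiations E F j.

End DAE.

Section Semidiscrete.
Context {R : realType} {V Q Q0 : normedModType R}.
Context (emb : {linear Q -> Q0}).
Context (a : {bilinear V -> V -> R | *%R & *%R}).
Context (k : {bilinear Q -> Q -> R | *%R & *%R}).
Context (b : {bilinear V -> Q0 -> R | *%R & *%R}).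

Definition first_equation (Vh : set V) (u : V) (p : Q) (f : dual V) : Prop :=
  forall v, Vh v -> a u v - b v (emb p) = f v.

Definition second_equation (Qh : set Q) (du : V) (p : Q) (g : dual Q) : Prop :=
  forall q, Qh q -> b du (emb q) + k p q = g q.

Definition semidiscrete_solution (T : R) (Vh : set V) (Qh : set Q)
    (f : R -> dual V) (g : R -> dual Q) (u : R -> V) (p : R -> Q) : Prop :=
  exists (du : R -> V) (dp : R -> Q),
    [/\ H1_with_derivative T Vh u du, H1_with_derivative T Qh p dp &
      {ae @lebesgue_measure R, forall t, t \in `]0, T[ ->
        first_equation Vh (u t) (p t) (f t) /\
        second_equation Qh (du t) (p t) (g t)}].

(* Coefficients of the semidiscrete system in bases phi, psi of Vh, Qh:
   x = (c, d) with u = \sum_j c_j phi_j, p = \sum_j d_j psi_j, the equations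
   being tested with the phi_i and the psi_i. *)
Section Matrices.
Context (n m : nat) (phi : 'I_n -> V) (psi : 'I_m -> Q).

Definition a_matrix : 'M[R]_n := \matrix_(i, j) a (phi j) (phi i).
Definition k_matrix : 'M[R]_m := \matrix_(i, j) k (psi j) (psi i).
Definition b_matrix : 'M[R]_(m, n) := \matrix_(i, j) b (phi j) (emb (psi i)).

Definition dae_E : 'M[R]_(n + m) := block_mx 0 0 b_matrix 0.
Definition dae_F : 'M[R]_(n + m) := block_mx a_matrix (- b_matrix^T) 0 k_matrix.

End Matrices.
End Semidiscrete.

(* Main.v *)
Require Import Defs.
From HB Require Import structures.
From mathcomp Require Import all_boot all_order all_algebra sesquilinear.
From mathcomp Require Import all_classical all_reals all_analysis.
From mathcomp Require Import measurable_realfun ring.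

Set Implicit Arguments.
Unset Strict Implicit.
Unset Printing Implicit Defensive.
Import Order.TTheory GRing.Theory Num.Theory.
Import numFieldNormedType.Exports.
Local Open Scope classical_set_scope.
Local Open Scope ring_scope.

(** In bases of [Vh] and [Qh] the problem reads [A c - B^T d = F] and
[B c' + K d = G], with [A] and [K] positive definite.

Regularity and the index follow from one computation: testing the block rows
with [c] and [d] and adding makes the off-diagonal terms cancel, so that only
the definite forms of [A] and [K] remain. Applied to [E + F] this gives a trivial
kernel ([saddle_point_regular]); applied to the system together with its time
derivative it shows that [x'] is determined, and is therefore a combination of
these equations ([saddle_point_ode1]). Without differentiation [x'] occurs only
through [E], which is nilpotent ([saddle_point_ode0]).

The discrete inf-sup condition amounts to injectivity of [B^T]
([infsup_stable_ker0], [ker0_infsup_stable]). In that case the Schur complement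
[S = B A^-1 B^T] is invertible, and eliminating [c] leaves the ordinary
differential equation [S d' + K d = G - B A^-1 F']. Its right-hand side is only
square integrable in time. Existence is therefore deduced from the equation
integrated once: the primitive [D] of [d] solves an equation [S D' + K D = r] with
a continuous [r], by means of the matrix exponential ([linear_ode_solution],
[saddle_point_system_solution]); [d = D'] then has a weak derivative because [r]
has one. The condition on the initial values is what makes [d 0] equal to the
prescribed value. For uniqueness, the functions [b (u t) (emb (psi i))] of the
difference of two solutions satisfy a homogeneous linear differential equation
in the weak sense; by the lemma of du Bois-Reymond ([du_bois_reymond]) they
satisfy it classically, and so they vanish ([weak_linear_ode_unique]).

If the inf-sup condition fails, some nonzero [q] in [Qh] satisfies [b v q = 0] on
[Vh]. The second equation tested with [q] is then the hidden constraint
[k (p t) q = g t q], which, [p] being continuous, fixes [k (p 0) q]. The algebraic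
equation at time zero allows [q] to be added to [p 0], so that it admits initial
values without a solution ([semidiscrete_incompatible]). *)

(** * Definite matrices and the matrix pencil *)

Section DefiniteMatrices.
Context {R : realType}.

(** Positive definiteness, in the form in which it is used: to conclude that a
vector vanishes. *)
Definition definite_mx n (A : 'M[R]_n) : Prop :=
  forall x : 'cV[R]_n, (x^T *m A *m x) 0 0 <= 0 -> x = 0.

Lemma colmx_eq0 n p (Z : 'M[R]_(n, p)) : (forall j, col j Z = 0) -> Z = 0.
Proof.
by move=> Z0; apply/matrixP => i j; have /colP/(_ i) := Z0 j; rewrite !mxE.
Qed.

Lemma mx_ker0_unitmx n (A : 'M[R]_n) :
  (forall x : 'cV[R]_n, A *m x = 0 -> x = 0) -> A \in unitmx.
Proof.
move=> A0; rewrite -unitmx_tr -row_free_unit -kermx_eq0 -trmx_eq0; apply/eqP.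
have AZ : A *m (kermx A^T)^T = 0.
  by apply: trmx_inj; rewrite trmx_mul trmxK mulmx_ker trmx0.
by apply: colmx_eq0 => j; apply: A0; rewrite colE mulmxA AZ mul0mx.
Qed.

Lemma definite_mx_ker0 n (A : 'M[R]_n) (x : 'cV[R]_n) :
  definite_mx A -> A *m x = 0 -> x = 0.
Proof. by move=> dA Ax; apply: dA; rewrite -mulmxA Ax mulmx0 mxE. Qed.

Lemma definite_mx_unit n (A : 'M[R]_n) : definite_mx A -> A \in unitmx.
Proof. by move=> dA; apply: mx_ker0_unitmx => x; exact: definite_mx_ker0. Qed.

Lemma definite_mx_ge0 n (A : 'M[R]_n) (x : 'cV[R]_n) :
  definite_mx A -> 0 <= (x^T *m A *m x) 0 0.
Proof.
move=> dA; rewrite leNgt; apply/negP => h; have x0 := dA x (ltW h).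
by move: h; rewrite x0 mulmx0 mxE ltxx.
Qed.

Lemma mx11_tr (x : 'M[R]_1) : x^T = x.
Proof. by apply/matrixP => i j; rewrite mxE !ord1. Qed.

Lemma dot_mulmx n m (B : 'M[R]_(m, n)) (x : 'cV[R]_n) (y : 'cV[R]_m) :
  x^T *m (B^T *m y) = y^T *m (B *m x).
Proof. by rewrite -[LHS]mx11_tr trmx_mul trmxK trmx_mul trmxK mulmxA. Qed.

(** With [x := invmx A *m B^T *m y], the quadratic form of the Schur complement
at [y] is that of [A] at [x]. *)
Lemma definite_mx_schur n m (A : 'M[R]_n) (B : 'M[R]_(m, n)) :
  definite_mx A -> (forall y : 'cV[R]_m, B^T *m y = 0 -> y = 0) ->
  definite_mx (B *m invmx A *m B^T).
Proof.
move=> dA B0 y hy; apply: B0.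
have uA := definite_mx_unit dA.
have [x xE] : exists x, x = invmx A *m (B^T *m y) by eexists.
have Ax : A *m x = B^T *m y by rewrite xE mulmxA mulmxV ?mul1mx.
rewrite -Ax; suff -> : x = 0 by rewrite mulmx0.
apply: dA; rewrite -mulmxA Ax dot_mulmx xE !mulmxA.
by rewrite !mulmxA in hy.
Qed.

End DefiniteMatrices.

Section SaddlePointPencil.
Context {R : realType} {n m : nat}.
Context (A : 'M[R]_n) (K : 'M[R]_m) (B : 'M[R]_(m, n)).
Context (dA : definite_mx A) (dK : definite_mx K).

Let E : 'M[R]_(n + m) := block_mx 0 0 B 0.
Let F : 'M[R]_(n + m) := block_mx A (- B^T) 0 K.

(** Testing the two block rows of [(E + F) (c, d) = 0] with [c] and [d] and
adding, the off-diagonal terms cancel. *)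
Lemma saddle_point_regular : regular_pencil E F.
Proof.
exists 1; rewrite scale1r -unitfE -unitmxE; apply: mx_ker0_unitmx => x.
rewrite -[x]vsubmxK; set c := usubmx x; set d := dsubmx x.
rewrite /E /F add_block_mx !(add0r, addr0) mul_block_col -[RHS]col_mx0.
move=> /eq_col_mx[/eqP h1 h2].
move: h1; rewrite mulNmx subr_eq0 => /eqP h1.
have h3 : (c^T *m A *m c) 0 0 + (d^T *m K *m d) 0 0 = 0.
  have := congr1 (fun z : 'cV_m => (d^T *m z) 0 0) h2.
  by rewrite /= mulmxDr mxE mulmx0 [RHS]mxE -dot_mulmx -h1 !mulmxA.
have c0 : c = 0.
  apply: dA; move/eqP: h3; rewrite addr_eq0 => /eqP ->.
  by rewrite oppr_le0 definite_mx_ge0.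
have d0 : d = 0 by apply: dK; move: h3; rewrite c0 mulmx0 mxE add0r => ->.
by rewrite c0 d0 col_mx0.
Qed.

(** A combination of [E x' + F x] and its derivative that isolates [x'] exists
as soon as the first component vanishes on the kernel of the derivative array
[(E 0; F E)]; this is seen by testing, as for regularity. *)
Lemma saddle_point_ode1 : ode_after_differentiations E F 1.
Proof.
pose M : 'M[R]_((n + m) + (n + m)) := block_mx E 0 F E.
have : (row_mx (1%:M : 'M[R]_(n + m)) (0 : 'M[R]_(n + m, n + m)) <= M)%MS.
  rewrite submxE; have := mulmx_coker M; move: (cokermx M) => Z MZ.
  rewrite -[Z]vsubmxK mul_row_col mul1mx mul0mx addr0.
  apply/eqP/colmx_eq0 => j.
  have : M *m (Z *m delta_mx j (0 : 'I_1)) = 0 by rewrite mulmxA MZ mul0mx.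
  have -> : Z *m delta_mx j (0 : 'I_1) =
      col_mx (col j (usubmx Z)) (col j (dsubmx Z)).
    by rewrite !colE -mul_col_mx vsubmxK.
  set Z1 := col j (usubmx Z); set Z2 := col j (dsubmx Z).
  rewrite -[Z1]vsubmxK -[Z2]vsubmxK.
  move: (usubmx Z1) (dsubmx Z1) (usubmx Z2) (dsubmx Z2) => c d c' d'.
  rewrite /M mul_block_col mul0mx addr0 -[RHS]col_mx0 => /eq_col_mx[].
  rewrite /E /F !mul_block_col !(mul0mx, add0r, addr0) add_col_mx addr0.
  rewrite -[RHS]col_mx0 => /eq_col_mx[_ Bc].
  rewrite -[RHS]col_mx0 => /eq_col_mx[/eqP].
  rewrite mulNmx subr_eq0 => /eqP Ac Kd.
  have c0 : c = 0.
    by apply: dA; rewrite -mulmxA Ac dot_mulmx Bc mulmx0 mxE.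
  have Bd : B^T *m d = 0 by rewrite -Ac c0 mulmx0.
  have d0 : d = 0.
    apply: dK; move: Kd => /(congr1 (mulmx d^T)).
    by rewrite mulmxDr -(dot_mulmx B) Bd !mulmx0 addr0 mulmxA => ->; rewrite mxE.
  by rewrite c0 d0 col_mx0.
move=> /submxP[D]; rewrite -[D]hsubmxK /M mul_row_block mulmx0 add0r.
set G0 := lsubmx D; set G1 := rsubmx D => /eq_row_mx[h0 h1].
exists (fun i => if i == 0 :> 'I_2 then G0 else G1), (G0 *m F) => x.
rewrite !big_ord_recl big_ord0 addr0 /= !mulmxDr !mulmxA -h1 mul0mx add0r.
by rewrite addrAC -mulmxDl -h0 mul1mx.
Qed.

(** Without differentiation the coefficient of [x'] is a multiple of [E],
whose square is zero. *)
Lemma saddle_point_ode0 : (0 < n + m)%N -> ~ ode_after_differentiations E F 0.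
Proof.
move=> nm_gt0 [G [C GC]].
have EE : E *m E = 0 by rewrite /E mulmx_block !(mul0mx, mulmx0) !addr0 -block_mx0.
have GE (y : 'cV[R]_(n + m)) : G ord0 *m E *m y = y.
  have := GC (fun j => if j == 1%N then y else 0).
  by rewrite big_ord_recl big_ord0 /= !mulmx0 !addr0 mulmxA.
pose i : 'I_(n + m) := Ordinal nm_gt0.
have E0 : E = 0.
  apply: colmx_eq0 => j.
  by rewrite colE -[LHS]GE -mulmxA (mulmxA E) EE mul0mx mulmx0.
have /colP/(_ i) := GE (const_mx 1).
by rewrite E0 mulmx0 mul0mx !mxE => /eqP; rewrite eq_sym oner_eq0.
Qed.

Lemma saddle_point_index1 : (0 < n + m)%N -> differentiation_index E F 1.
Proof.
move=> nm_gt0; split; first exact: saddle_point_ode1.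
by move=> j; rewrite ltnS leqn0 => /eqP ->; exact: saddle_point_ode0.
Qed.

End SaddlePointPencil.

(** * Linear differential equations with constant coefficients *)

Section MatrixExponential.
Context {R : realType}.

Definition mx_is_derive p q (F : R -> 'M[R]_(p, q)) (t : R) (D : 'M[R]_(p, q)) :=
  forall i j, is_derive t 1 (fun s => F s i j) (D i j).

Lemma mx_is_deriveM p q r (F : R -> 'M[R]_(p, q)) (G : R -> 'M[R]_(q, r)) t D D' :
  mx_is_derive F t D -> mx_is_derive G t D' ->
  mx_is_derive (fun s => F s *m G s) t (D *m G t + F t *m D').
Proof.
move=> dF dG i j.
have -> : (fun s => (F s *m G s) i j) = \sum_l (fun s => F s i l * G s l j).
  by apply/funext => s; rewrite mxE fct_sumE.
have -> : (D *m G t + F t *m D') i j =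
    \sum_l (F t i l *: D' l j + G t l j *: D i l).
  rewrite !mxE -big_split /=; apply: eq_bigr => l _.
  by rewrite addrC; congr (_ + _); exact: mulrC.
apply: is_derive_sum => l; exact: is_deriveM.
Qed.

Context {m : nat} (A : 'M[R]_m).

(** Geometric growth, which bounds the exponential series of [A] by a scalar
one. *)
Lemma expr_mx_bound (P : 'M[R]_m) : exists b c : R, [/\ 0 <= b, 0 <= c &
  forall k i j, `|(P *m A ^+ k) i j| <= b * c ^+ k].
Proof.
pose c := \sum_i \sum_j `|A i j|; pose b := \sum_i \sum_j `|P i j|.
have b0 : 0 <= b by do 2 apply: sumr_ge0 => ? _.
have c0 : 0 <= c by do 2 apply: sumr_ge0 => ? _.
exists b, c; split=> // k; elim: k => [|k IH] i j.
  rewrite expr0 mulmx1 mulr1 /b (bigD1 i)//= (bigD1 j)//= -addrA lerDl.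
  by rewrite addr_ge0// ?sumr_ge0// => ? _; exact: sumr_ge0.
rewrite exprSr mulmxA mxE (le_trans (ler_norm_sum _ _ _))//.
rewrite exprSr mulrA (@le_trans _ _ (\sum_l b * c ^+ k * `|A l j|))//.
  by apply: ler_sum => l _; rewrite normrM ler_wpM2r.
rewrite -mulr_sumr ler_wpM2l ?mulr_ge0 ?exprn_ge0//.
apply: ler_sum => l _; rewrite (bigD1 j)//= lerDl sumr_ge0//.
Qed.

Let coef (P : 'M[R]_m) i j k := (P *m A ^+ k) i j / k`!%:R.

Lemma cvg_expm_series P i j t : cvgn (pseries (coef P i j) t).
Proof.
have [b [c [b0 c0 bc]]] := expr_mx_bound P.
apply: normed_cvg; rewrite /normed_series_of /=.
apply: (@series_le_cvg _ _ (b *: exp_coeff (c * `|t|))) => [k|k|k|].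
- exact: normr_ge0.
- by rewrite mulr_ge0// divr_ge0// exprn_ge0// mulr_ge0.
- rewrite /coef !normrM normfV normr_nat normrX.
  rewrite [leRHS](_ : _ = b * c ^+ k / k`!%:R * `|t| ^+ k).
    by rewrite ler_wpM2r ?exprn_ge0// ler_wpM2r ?invr_ge0.
  change (b * ((c * `|t|) ^+ k / k`!%:R) = b * c ^+ k / k`!%:R * `|t| ^+ k).
  by rewrite exprMn -!mulrA; congr (_ * (_ * _)); exact: mulrC.
- by apply: is_cvg_seriesZ; exact: is_cvg_series_exp_coeff.
Qed.

(** The exponential series with a matrix factor [P] on the left, so that a
term-wise derivative is again of this form. *)
Definition expm_from (P : 'M[R]_m) (t : R) : 'M[R]_m :=
  \matrix_(i, j) limn (pseries (coef P i j) t).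

Lemma expm_from_derive P t : mx_is_derive (expm_from P) t (expm_from (P *m A) t).
Proof.
have dcoef Q i j : pseries_diffs (coef Q i j) = coef (Q *m A) i j.
  apply/funext => k; rewrite /pseries_diffs /coef exprS mulmxA factS natrM invfM.
  by rewrite mulrCA mulVKf.
move=> i j; rewrite mxE -dcoef.
have -> : (fun s => expm_from P s i j) = (fun s => limn (pseries (coef P i j) s)).
  by apply/funext => s; rewrite mxE.
apply: (@pseries_snd_diffs _ _ (`|t| + 1)); rewrite ?dcoef.
- exact: cvg_expm_series.
- exact: cvg_expm_series.
- exact: cvg_expm_series.
- by rewrite [ltRHS]ger0_norm ?ltrDl// addr_ge0.
Qed.

Definition expm := expm_from 1%:M.

Lemma lim_pseries_lincomb n (u : R^nat) (a : 'I_n -> R) (c : 'I_n -> R^nat) t :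
  (forall k, u k = \sum_l a l * c l k) -> (forall l, cvgn (pseries (c l) t)) ->
  limn (pseries u t) = \sum_l a l * limn (pseries (c l) t).
Proof.
move=> uE cc; apply/cvg_lim => //.
have -> : pseries u t = fun N => \sum_l a l * pseries (c l) t N.
  apply/funext => N; rewrite /pseries /series /=.
  under [RHS]eq_bigr do rewrite mulr_sumr.
  rewrite exchange_big /=; apply: eq_bigr => k _; rewrite uE mulr_suml.
  by apply: eq_bigr => l _; rewrite mulrA.
apply: cvg_big => [|l _]; last by exact: cvgMr (cc l).
  by move=> ?; exact: add_continuous.
Qed.

Lemma expm_fromE P t : expm_from P t = P *m expm t.
Proof.
apply/matrixP => i j; rewrite !mxE.
under eq_bigr do rewrite mxE.
apply: lim_pseries_lincomb => [k|l]; last exact: cvg_expm_series.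
rewrite /coef mxE mulr_suml.
by apply: eq_bigr => l _; rewrite mul1mx mulrA.
Qed.

Lemma expm_comm t : expm t *m A = A *m expm t.
Proof.
rewrite -expm_fromE; apply/matrixP => i j; rewrite !mxE.
under eq_bigr do rewrite mxE mulrC.
symmetry; apply: lim_pseries_lincomb => [k|l]; last exact: cvg_expm_series.
rewrite /coef -[A *m A ^+ k]exprS exprSr mxE mulr_suml.
by apply: eq_bigr => l _; rewrite mul1mx mulrA (mulrC (A l j)).
Qed.

Lemma expm_derive t : mx_is_derive expm t (A *m expm t).
Proof.
by rewrite -expm_fromE -[X in expm_from X]mul1mx; exact: expm_from_derive.
Qed.

Lemma expm0 : expm 0 = 1%:M.
Proof.
apply/matrixP => i j; rewrite mxE.
have -> : limn (pseries (coef 1%:M i j) 0) = coef 1%:M i j 0.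
  apply/cvg_lim => //; rewrite -(cvg_shiftn 1).
  apply: cvg_near_cst; near=> n; rewrite /pseries /series /= addn1.
  rewrite big_nat_recl// expr0 mulr1 big1 ?addr0// => k _.
  by rewrite expr0n mulr0.
by rewrite /coef expr0 mulmx1 divr1.
Unshelve. all: by end_near. Qed.

Lemma mx_is_derive_opp p q (F : R -> 'M[R]_(p, q)) t D :
  mx_is_derive F (- t) D -> mx_is_derive (fun s => F (- s)) t (- D).
Proof.
move=> dF i j; rewrite mxE -mulrN1.
exact: (@is_derive1_comp _ (fun s => F s i j) (fun s => - s)).
Qed.

(** The product is constant, as [expm] commutes with [A]. *)
Lemma expmN t : expm t *m expm (- t) = 1%:M.
Proof.
have d0 s : mx_is_derive (fun s => expm s *m expm (- s)) s 0.
  have := mx_is_deriveM (expm_derive s) (mx_is_derive_opp (expm_derive (- s))).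
  by rewrite mulmxN (mulmxA (expm s)) expm_comm subrr.
apply/matrixP => i j.
have -> : (1%:M : 'M[R]_m) = expm 0 *m expm (- 0) by rewrite oppr0 expm0 mul1mx.
apply: (@is_derive_0_is_cst R (fun s => (expm s *m expm (- s)) i j)) => s.
by have := d0 s i j; rewrite mxE.
Qed.

End MatrixExponential.

Section LinearODE.
Context {R : realType}.
Notation mu := (@lebesgue_measure R).

Lemma continuous_antiderivative (w : R -> R) : continuous w ->
  exists2 W : R -> R, W 0 = 0 & forall t : R, is_derive t (1 : R) W (w t).
Proof.
move=> cw.
have iw (a b : R) : mu.-integrable `[a, b] (EFin \o w).
  apply: continuous_compact_integrable; first exact: segment_compact.
  exact: continuous_subspaceT.
pose I a t := \int[mu]_(s in `[a, t]) w s.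
have II a b t : a <= b -> b <= t -> I a t = I a b + I b t.
  move=> ab bt; rewrite /I.
  have := @Rintegral_itvB R w (BLeft a) (BRight t) b (iw _ _).
  rewrite !bnd_simp => /(_ ab bt) /eqP.
  rewrite subr_eq => /eqP ->; rewrite addrC; congr (_ + _).
  apply: Rintegral_itv_obnd_cbnd; apply: integrableS (iw b t) => //.
  exact: subset_itv_oc_cc.
(* The integral starts to the left of [0] and of [t]; by [WE] the starting point
is immaterial. *)
pose W t := I (- (`|t| + 1)) t - I (- (`|t| + 1)) 0.
have WE a t : a <= t -> a <= 0 -> W t = I a t - I a 0.
  move=> at_ a0; rewrite /W.
  wlog : a at_ a0 / a <= - (`|t| + 1).
    move=> h; set c := - (`|t| + 1).
    have [ca|] := leP a c; first exact: h.
    move=> /ltW ca.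
    by rewrite (II c a t)// (II c a 0)// opprD addrACA subrr add0r.
  set c := - _ => ac.
  have ct : c <= t by rewrite lerNl (le_trans (ler_norm _))// normrN lerDl.
  have c0 : c <= 0 by rewrite lerNl oppr0 addr_ge0.
  by rewrite (II a c t)// (II a c 0)// opprD addrACA subrr add0r.
exists W; first by rewrite /W subrr.
move=> t; pose a := - (`|t| + 2).
have at_ : a < t.
  by rewrite ltrNl (le_lt_trans (ler_norm _))// normrN ltrDl.
have a0 : a <= 0 by rewrite lerNl oppr0 addr_ge0.
have t1 : t < t + 1 by rewrite ltrDl.
have [dI I'] := @continuous_FTC1_closed R w a t _ t1 (iw _ _) at_ (cw t).
have dIt : is_derive t (1 : R) (I a) (w t).
  by rewrite -I' derive1E; exact/derivableP.
have dW : is_derive t (1 : R) (I a - cst (I a 0)) (w t).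
  by rewrite -[w t]subr0; exact: is_deriveB.
apply: near_eq_is_derive dW; near=> s.
by rewrite [RHS](WE a)// ltW//; near: s; exact: lt_nbhsr.
Unshelve. all: by end_near. Qed.

Lemma is_derive_continuous (f df : R -> R) :
  (forall t : R, is_derive t (1 : R) f (df t)) -> continuous f.
Proof.
move=> d t; apply/differentiable_continuous/derivable1_diffP.
by have [] := d t.
Qed.

(** Variation of constants: [expm A t *m Z t], where [Z] is a primitive of
[expm A (- t) *m w t]. *)
Lemma linear_ode_solution m (A : 'M[R]_m) (w : R -> 'cV[R]_m) :
  (forall i, continuous (fun t => w t i 0)) ->
  exists2 y : R -> 'cV[R]_m, y 0 = 0 &
    forall t, mx_is_derive y t (A *m y t + w t).
Proof.
move=> cw.
have cv i : continuous (fun t => (expm A (- t) *m w t) i 0).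
  have -> : (fun t => (expm A (- t) *m w t) i 0) =
      (fun t => \sum_l expm A (- t) i l * w t l 0).
    by apply/funext => t; rewrite mxE.
  apply: continuous_big => [|l _ t]; first by move=> ?; exact: add_continuous.
  apply: continuousM; last exact: cw.
  exact: (is_derive_continuous
    (fun s => mx_is_derive_opp (expm_derive A (- s)) i l)).
have /choice[z zP] : forall i, exists W : R -> R, W 0 = 0 /\
    forall t : R, is_derive t (1 : R) W ((expm A (- t) *m w t) i 0).
  by move=> i; have [W W0 dW] := continuous_antiderivative (cv i); exists W.
pose Z t : 'cV[R]_m := \col_i z i t.
exists (fun t => expm A t *m Z t) => [|t].
  suff -> : Z 0 = 0 by rewrite mulmx0.
  by apply/colP => i; rewrite !mxE; case: (zP i).
have dZ : mx_is_derive Z t (expm A (- t) *m w t).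
  move=> i j; rewrite ord1.
  have -> : (fun s => Z s i 0) = z i by apply/funext => s; rewrite mxE.
  by have [_] := zP i.
have := mx_is_deriveM (expm_derive A t) dZ.
by rewrite !mulmxA expmN mul1mx.
Qed.

End LinearODE.

(** * Weak derivatives of real functions *)

Section ScalarCalculus.
Context {R : realType}.
Notation mu := (@lebesgue_measure R).
Implicit Types (h H phi w W : R -> R) (T : R).

Lemma continuous_integrable_itv (i : interval R) (a b : R) h :
  [set` i] `<=` `[a, b] -> continuous h -> mu.-integrable [set` i] (EFin \o h).
Proof.
move=> iab ch; apply: (@integrableS _ _ _ mu `[a, b]) => //.
apply: continuous_compact_integrable; first exact: segment_compact.
exact: continuous_subspaceT.
Qed.

Lemma Rintegral_oo_is_derive a b h H : a < b -> continuous h ->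
  (forall t : R, is_derive t (1 : R) H (h t)) ->
  \int[mu]_(t in `]a, b[) h t = H b - H a.
Proof.
move=> ab ch dH.
have ih (i : interval R) :
    [set` i] `<=` `[a, b] -> mu.-integrable [set` i] (EFin \o h).
  by move=> iab; exact: (continuous_integrable_itv iab).
rewrite Rintegral_itv_bndo_bndc; last by apply: ih; exact: subset_itv_oo_cc.
rewrite Rintegral_itv_obnd_cbnd; last by apply: ih; exact: subset_itv_oc_cc.
rewrite /Rintegral (@continuous_FTC2 _ h H a b)//.
- exact: continuous_subspaceT.
- have cH := is_derive_continuous dH.
  split; first by move=> x _; have [] := dH x.
    exact/cvg_at_right_filter/cH.
  exact/cvg_at_left_filter/cH.
- by move=> x _; rewrite derive1E; have [_ ->] := dH x.
Qed.

Lemma test_function_continuous T phi : test_function T phi ->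
  [/\ continuous phi, continuous (derive1 phi),
      forall t : R, is_derive t (1 : R) phi (derive1 phi t),
      forall t, t <= 0 -> phi t = 0 & forall t, T <= t -> phi t = 0].
Proof.
move=> [dphi cphi' [c [d [c0 dT phi0]]]].
have dphi' (t : R) : is_derive t (1 : R) phi (derive1 phi t).
  by rewrite derive1E; exact/derivableP.
split=> //; first exact: is_derive_continuous dphi'.
- by move=> t t0; apply: phi0; rewrite in_itv/= leNgt (le_lt_trans t0).
- by move=> t tT; apply: phi0; rewrite in_itv/= (leNgt t) (lt_le_trans dT) ?andbF.
Qed.

Lemma Rintegral_by_parts_test T phi w W : 0 < T -> test_function T phi ->
  continuous w -> (forall t : R, is_derive t (1 : R) W (w t)) ->
  \int[mu]_(t in `]0, T[) (derive1 phi t * W t) =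
  - \int[mu]_(t in `]0, T[) (phi t * w t).
Proof.
move=> T0 /test_function_continuous[cphi cphi' dphi phi0 phiT] cw dW.
have cW := is_derive_continuous dW.
have c1 : continuous (fun t => derive1 phi t * W t).
  by move=> t; apply: continuousM; [exact: cphi'|exact: cW].
have c2 : continuous (fun t => phi t * w t).
  by move=> t; apply: continuousM; [exact: cphi|exact: cw].
have ii h : continuous h -> mu.-integrable `]0, T[ (EFin \o h).
  exact: (@continuous_integrable_itv `]0, T[ 0 T h (@subset_itv_oo_cc _ _ _ _)).
apply/eqP; rewrite -addr_eq0 -RintegralD//; [|exact: (ii _ c1)|exact: (ii _ c2)].
have cc : continuous (fun t => derive1 phi t * W t + phi t * w t).
  by move=> t; apply: cvgD; [exact: c1|exact: c2].
have dd t : is_derive t (1 : R) (fun t => phi t * W t)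
    (derive1 phi t * W t + phi t * w t).
  have -> : derive1 phi t * W t + phi t * w t =
      phi t *: w t + W t *: derive1 phi t.
    by rewrite addrC; congr (_ + _); exact: mulrC.
  exact: is_deriveM.
by rewrite (Rintegral_oo_is_derive T0 cc dd) (phi0 0)// (phiT T)// !mul0r subrr.
Qed.

(** The derivative vanishes outside [(p, q)], so that [H] keeps on either side
the value zero that it has at [p] and at [q]. *)
Lemma test_function_antiderivative T p q h H : 0 < p -> p < q -> q < T ->
  continuous h -> (forall t : R, is_derive t (1 : R) H (h t)) ->
  H p = 0 -> H q = 0 -> (forall t, t \notin `]p, q[ -> h t = 0) ->
  test_function T H.
Proof.
move=> p0 pq qT ch dH Hp Hq h0.
have dHE : derive1 H = h.
  by apply/funext => t; rewrite derive1E; have [_ ->] := dH t.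
split; [by move=> t; have [] := dH t|by rewrite dHE|].
exists p, q; split => // t; rewrite in_itv/= negb_and -!ltNge => /orP[tp|qt].
- rewrite -Hp; apply/eqP; rewrite eq_sym -subr_eq0.
  rewrite -(Rintegral_oo_is_derive tp ch dH); apply/eqP.
  rewrite (@eq_Rintegral _ _ _ _ _ (cst 0)) ?Rintegral_cst ?mul0r// => s.
  by rewrite inE /= in_itv/= => /andP[_ sp]; rewrite h0// in_itv/= ltNge (ltW sp).
- rewrite -Hq; apply/eqP; rewrite -subr_eq0.
  rewrite -(Rintegral_oo_is_derive qt ch dH); apply/eqP.
  rewrite (@eq_Rintegral _ _ _ _ _ (cst 0)) ?Rintegral_cst ?mul0r// => s.
  rewrite inE /= in_itv/= => /andP[qs _]; rewrite h0// in_itv/= (ltNge s) (ltW qs).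
  by rewrite andbF.
Qed.

(** Near a point of [[a, b]] where the functions differ, end points included,
they would differ on an interval of positive measure. *)
Lemma continuous_ae_eq a b h w : a < b ->
  {within `[a, b], continuous h} -> {within `[a, b], continuous w} ->
  {ae mu, forall t, t \in `]a, b[ -> h t = w t} ->
  forall t, t \in `[a, b] -> h t = w t.
Proof.
move=> ab ch cw [N [mN N0 hN]] t tab; apply: contrapT => htw.
have : (h s - w s) @[s --> within `[a, b] (nbhs t)] --> h t - w t.
  apply: cvgB; first by move/subspace_continuousP : ch; exact.
  by move/subspace_continuousP : cw; exact.
move=> /cvgr_neq0; rewrite subr_eq0 => /(_ (introN eqP htw)).
move=> /nbhs_ballP[e /= e0 he].
pose p := Num.max a (t - e); pose q := Num.min b (t + e).
move: (tab); rewrite in_itv/= => /andP[at_ tb].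
have pq : p < q.
  rewrite lt_min !gt_max ab /=; apply/and3P; split.
  - by rewrite (lt_le_trans _ tb)// ltrBlDr ltrDl.
  - by rewrite (le_lt_trans at_)// ltrDl.
  - by rewrite ltrBlDr -addrA ltrDl addr_gt0.
have pqN : `]p, q[ `<=` N.
  move=> s /=; rewrite in_itv/= gt_max lt_min => /andP[/andP[as_ ts] /andP[sb st]].
  apply: hN => /= hs.
  have sab : s \in `]a, b[ by rewrite in_itv/= as_ sb.
  have : h s - w s != 0.
    apply: he; last by apply: subset_itv_oo_cc; exact: sab.
    by rewrite /ball /= ltr_distlC ts st.
  by rewrite hs// subrr eqxx.
have : (mu `]p, q[ <= mu N)%E by apply: le_measure => //; rewrite inE.
rewrite N0 lebesgue_measure_itv/= lte_fin pq -EFinB lee_fin leNgt.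
by rewrite subr_gt0 pq.
Qed.

(** By composition with the projection of the line onto [[a, b]]. *)
Lemma continuous_extension a b h : a < b -> {within `[a, b], continuous h} ->
  exists2 H, continuous H & forall t, t \in `[a, b] -> H t = h t.
Proof.
move=> ab /subspace_continuousP ch.
pose clamp t : R := Num.min b (Num.max a t).
have clamp_itv t : clamp t \in `[a, b].
  by rewrite in_itv/= le_min ge_min le_max !lexx (ltW ab).
have cclamp : continuous clamp.
  move=> t; apply: (@continuous_min _ _ (cst b) (fun t => Num.max a t)).
    exact: cvg_cst.
  by apply: (@continuous_max _ _ (cst a) id); [exact: cvg_cst|exact: cvg_id].
exists (h \o clamp) => [t|t]; last first.
  by rewrite in_itv/= => /andP[at_ tb]; rewrite /= /clamp max_r// min_r.
apply: (@cvg_comp _ _ _ clamp h _ _ _ _ (ch _ (clamp_itv t))) => U hU.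
have := cclamp t [set s | s \in `[a, b] -> U s] hU.
change (nbhs t [set s | clamp s \in `[a, b] -> U (clamp s)] ->
  nbhs t [set s | U (clamp s)]).
by apply: filterS => s; apply; exact: clamp_itv.
Qed.

(** A nondecreasing function with equal values at both end points is constant. *)
Lemma is_derive_ge0_eq a b h H : a < b ->
  (forall t : R, is_derive t (1 : R) H (h t)) ->
  (forall t, t \in `]a, b[ -> 0 <= h t) -> H a = H b ->
  forall t, t \in `]a, b[ -> h t = 0.
Proof.
move=> ab dH h0 Hab.
have dHE t : derive1 H t = h t by rewrite derive1E; have [_ ->] := dH t.
have nd : {in `[a, b] &, {homo H : x y / x <= y >-> x <= y}}.
  apply: ger0_derive1_le_cc => [x _|x xab|].
  - by have [] := dH x.
  - by rewrite dHE h0.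
  - exact: continuous_subspaceT (is_derive_continuous dH).
have ain : a \in `[a, b] by rewrite in_itv/= lexx ltW.
have bin : b \in `[a, b] by rewrite in_itv/= lexx ltW.
have Hcst x : x \in `]a, b[ -> H x = H a.
  move=> xab; have xin := subset_itv_oo_cc xab.
  move: xab; rewrite in_itv/= => /andP[ax xb].
  by apply/eqP; rewrite eq_le {1}Hab !nd// ltW.
move=> t tab; rewrite -dHE derive1E -[RHS](derive_cst (H a) t 1).
apply: near_eq_derive; near=> s; apply: Hcst.
near: s; move: (tab); rewrite in_itv/= => /andP[at_ tb].
exact: near_in_itvoo.
Unshelve. all: by end_near. Qed.

(** The lemma of du Bois-Reymond. Let [r := h - W]; it is to be shown constant
on every interval [(p, q)] that is relatively compact in [(0, T)]. With a
continuous weight [chi] that is positive exactly on [(p, q)], take the test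
function with derivative [chi * (r - c)], where [c] is the weighted mean of
[r]; then [chi * (r - c) ^+ 2] has integral zero. *)
Lemma du_bois_reymond T h w W : 0 < T -> {within `[0, T], continuous h} ->
  continuous w -> (forall t : R, is_derive t (1 : R) W (w t)) ->
  (forall phi, test_function T phi ->
    \int[mu]_(t in `]0, T[) (derive1 phi t * h t) =
    - \int[mu]_(t in `]0, T[) (phi t * w t)) ->
  forall t, t \in `[0, T] -> h t - W t = h 0 - W 0.
Proof.
move=> T0 ch cw dW hw.
have cW := is_derive_continuous dW.
have [H cH Hh] := continuous_extension T0 ch.
pose r t := H t - W t.
have cr : continuous r by move=> t; apply: cvgB; [exact: cH|exact: cW].
have hr phi : test_function T phi ->
    \int[mu]_(t in `]0, T[) (derive1 phi t * r t) = 0.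
  move=> tphi; have [cphi cphi' dphi _ _] := test_function_continuous tphi.
  have ii g : continuous g ->
      mu.-integrable `]0, T[ (EFin \o (fun t => derive1 phi t * g t)).
    move=> cg; apply: (@continuous_integrable_itv `]0, T[ 0 T) => [|t].
      exact: subset_itv_oo_cc.
    by apply: continuousM; [exact: cphi'|exact: cg].
  under eq_Rintegral do rewrite /r mulrBr.
  rewrite RintegralB//; [|exact: ii|exact: ii].
  rewrite (Rintegral_by_parts_test T0 tphi cw dW) -hw//.
  apply/eqP; rewrite subr_eq0; apply/eqP/eq_Rintegral => t.
  by rewrite inE /= => t0T; rewrite Hh//; exact: subset_itv_oo_cc.
have rpq p q : 0 < p -> p < q -> q < T ->
    exists c, forall t, t \in `]p, q[ -> r t = c.
  move=> p0 pq qT.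
  pose chi t := Num.max 0 ((t - p) * (q - t)).
  have cchi : continuous chi.
    move=> t; apply: (@continuous_max _ _ (cst 0) (fun t => (t - p) * (q - t))).
      exact: cvg_cst.
    by apply: continuousM; apply: cvgB; (exact: cvg_cst || exact: cvg_id).
  have chi_gt0 t : t \in `]p, q[ -> 0 < chi t.
    by rewrite in_itv/= => /andP[pt tq]; rewrite lt_max mulr_gt0 ?orbT// subr_gt0.
  have chi_eq0 t : t \notin `]p, q[ -> chi t = 0.
    rewrite in_itv/= negb_and -!leNgt => tpq; apply: max_l.
    have [tp|pt] := leP t p.
      by rewrite mulr_le0_ge0 ?subr_le0// subr_ge0 (le_trans tp)// ltW.
    rewrite leNgt pt /= in tpq.
    by rewrite mulr_ge0_le0 ?subr_le0// subr_ge0 ltW.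
  have chi_ge0 t : 0 <= chi t by rewrite le_max lexx.
  have [X _ dX] := continuous_antiderivative cchi.
  have cchir : continuous (fun t => chi t * r t).
    by move=> t; apply: continuousM; [exact: cchi|exact: cr].
  have [Y _ dY] := continuous_antiderivative cchir.
  have Xpq : X q - X p != 0.
    apply/negP; rewrite subr_eq0 => /eqP/esym Xpq.
    have mpq : (p + q) / 2 \in `]p, q[ by rewrite in_itv/= !midf_lt.
    have := is_derive_ge0_eq pq dX (fun t _ => chi_ge0 t) Xpq mpq.
    by apply/eqP; rewrite gt_eqF// chi_gt0.
  pose c := (Y q - Y p) / (X q - X p); exists c.
  pose psi t := chi t * (r t - c).
  have cpsi : continuous psi.
    move=> t; apply: continuousM; first exact: cchi.
    by apply: cvgB; [exact: cr|exact: cvg_cst].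
  (* [Y' = chi * r] and [X' = chi]; the choice of [c] makes [phi q = 0]. *)
  pose phi t := (Y t - Y p) - c * (X t - X p).
  have dphi t : is_derive t (1 : R) phi (psi t).
    have -> : psi t = (chi t * r t - 0) - c *: (chi t - 0).
      by rewrite !subr0 /psi mulrBr; congr (_ - _); exact: mulrC.
    have d1 : is_derive t (1 : R) (Y - cst (Y p)) (chi t * r t - 0).
      exact: is_deriveB.
    have d2 : is_derive t (1 : R) (X - cst (X p)) (chi t - 0).
      exact: is_deriveB.
    exact: (is_deriveB d1 (is_deriveZ c d2)).
  have tphi : test_function T phi.
    apply: (test_function_antiderivative p0 pq qT cpsi dphi).
    - by rewrite /phi !subrr mulr0 subrr.
    - by rewrite /phi /c divfK// subrr.
    - by move=> t tpq; rewrite /psi chi_eq0// mul0r.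
  have phiE : derive1 phi = psi.
    by apply/funext => t; rewrite derive1E; have [_ ->] := dphi t.
  have cpsir : continuous (fun t => psi t * (r t - c)).
    move=> t; apply: continuousM; first exact: cpsi.
    by apply: cvgB; [exact: cr|exact: cvg_cst].
  have [Z _ dZ] := continuous_antiderivative cpsir.
  have Z0T : Z 0 = Z T.
    apply/esym/eqP; rewrite -subr_eq0 -(Rintegral_oo_is_derive T0 cpsir dZ).
    under eq_Rintegral do rewrite mulrBr.
    have ii g : continuous g -> mu.-integrable `]0, T[ (EFin \o g).
      apply: (@continuous_integrable_itv `]0, T[ 0 T).
      exact: subset_itv_oo_cc.
    have c1 : continuous (fun t => psi t * r t).
      by move=> t; apply: continuousM; [exact: cpsi|exact: cr].
    have c2 : continuous (fun t => psi t * c).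
      by move=> t; apply: continuousM; [exact: cpsi|exact: cvg_cst].
    rewrite RintegralB//; [|exact: ii|exact: ii].
    rewrite RintegralZr//; last exact: ii.
    rewrite (Rintegral_oo_is_derive T0 cpsi dphi) -phiE hr//.
    have [_ _ _ phi0 phiT] := test_function_continuous tphi.
    by rewrite (phi0 0)// (phiT T)// subrr mul0r subrr.
  move=> t tpq; apply/eqP; rewrite -subr_eq0.
  have t0T : t \in `]0, T[.
    move: tpq; rewrite !in_itv/= => /andP[pt tq].
    by rewrite (lt_trans p0 pt) (lt_trans tq).
  have ge0 s : s \in `]0, T[ -> 0 <= psi s * (r s - c).
    by move=> _; rewrite /psi -mulrA mulr_ge0// -expr2 sqr_ge0.
  have := is_derive_ge0_eq T0 dZ ge0 Z0T t0T.
  move/eqP; rewrite /psi !mulf_eq0 gt_eqF ?chi_gt0//=.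
  by rewrite orbb.
have mT : T / 2 \in `]0, T[.
  by rewrite in_itv/= divr_gt0// ltr_pdivrMr// ltr_pMr// ltr1n.
have rcst t : t \in `]0, T[ -> r t = r (T / 2).
  move=> t0T; pose p := Num.min t (T / 2) / 2.
  pose q := (Num.max t (T / 2) + T) / 2.
  move: t0T mT; rewrite !in_itv/= => /andP[t0 tT] /andP[m0 mT].
  have p0 : 0 < p by rewrite divr_gt0// lt_min t0 m0.
  have maxT : Num.max t (T / 2) < T by rewrite gt_max tT mT.
  have qT : q < T by rewrite /q midf_lt.
  have maxq : Num.max t (T / 2) < q by rewrite /q midf_lt.
  have pmin : p < Num.min t (T / 2).
    by rewrite /p ltr_pdivrMr// ltr_pMr ?ltr1n// lt_min t0 m0.
  have tpq : t \in `]p, q[.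
    rewrite in_itv/= (lt_le_trans pmin) ?ge_min ?lexx//=.
    by rewrite (le_lt_trans _ maxq)// le_max lexx.
  have mpq : T / 2 \in `]p, q[.
    rewrite in_itv/= (lt_le_trans pmin) ?ge_min ?lexx ?orbT//=.
    by rewrite (le_lt_trans _ maxq)// le_max lexx orbT.
  have pq : p < q by move: tpq; rewrite in_itv/= => /andP[/lt_trans]; apply.
  by have [c rc] := rpq p q p0 pq qT; rewrite !rc.
have rcst' t : t \in `[0, T] -> r t = r (T / 2).
  apply: (@continuous_ae_eq 0 T r (cst (r (T / 2)))) => //.
  - exact: continuous_subspaceT.
  - by apply: continuous_subspaceT => ?; exact: cvg_cst.
  - exact: aeW.
have z0T : 0 \in `[0, T] by rewrite in_itv/= lexx ltW.
by move=> t t0T; rewrite -(Hh t)// -(Hh 0)// -/(r t) -/(r 0) !rcst'.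
Qed.

Lemma continuous_bounded_itv a b h : {within `[a, b], continuous h} ->
  exists2 M, 0 < M & forall t, t \in `[a, b] -> `|h t| <= M.
Proof.
move=> ch.
have /compact_bounded[M [_ HM]] := continuous_compact ch (@segment_compact _ a b).
exists (`|M| + 1) => [|t tab]; first by rewrite ltr_pwDr.
by apply: (HM (`|M| + 1)); [rewrite ltr_pwDr// ler_norm|exists t].
Qed.

Lemma integrable_continuousM T w h : continuous w ->
  mu.-integrable `]0, T[ (EFin \o h) ->
  mu.-integrable `]0, T[ (EFin \o (fun t => w t * h t)).
Proof.
move=> cw ih.
have [M M0 HM] := continuous_bounded_itv (@continuous_subspaceT _ _ `[0, T] w cw).
have := @integrableMr _ _ _ mu `]0, T[ _ w _ _ _ ih; apply => //.
- by apply: measurable_funTS; exact: continuous_measurable_fun.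
- exists M; split; first exact: num_real.
  move=> x Mx t /= tT; rewrite (le_trans (HM t _)) ?ltW//.
  exact: subset_itv_oo_cc.
Qed.

(** By density of continuous functions in L1, the rule of integration by parts
extends from continuous functions to integrable ones. *)
Lemma integrable_primitive T h : 0 < T -> mu.-integrable `]0, T[ (EFin \o h) ->
  exists P : R -> R, [/\ P 0 = 0, {within `[0, T], continuous P} &
    forall phi, test_function T phi ->
      \int[mu]_(t in `]0, T[) (derive1 phi t * P t) =
      - \int[mu]_(t in `]0, T[) (phi t * h t)].
Proof.
move=> T0 ih.
pose h0 := h \_ `]0, T[.
have ih0 : mu.-integrable `[0, T] (EFin \o h0).
  rewrite /h0 -restrict_EFin; apply/integrable_restrict => //=.
  by rewrite setIidr//; exact: subset_itv_oo_cc.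
pose P t := \int[mu]_(s in `[0, t]) h0 s.
have cP : {within `[0, T], continuous P}.
  exact: (parameterized_integral_continuous (ltW T0) ih0).
have P0 : P 0 = 0 by rewrite /P set_itv1 Rintegral_set1.
have subt t : t <= T -> `]0, t[ `<=` `]0, T[.
  by move=> tT; apply: subset_itvl; rewrite bnd_simp.
have PE t : t \in `[0, T] -> P t = \int[mu]_(s in `]0, t[) h s.
  rewrite in_itv/= => /andP[t0 tT]; rewrite /P.
  have it : mu.-integrable `[0, t] (EFin \o h0).
    by apply: integrableS ih0 => //; apply: subset_itvl; rewrite bnd_simp.
  rewrite -Rintegral_itv_obnd_cbnd; last first.
    by apply: integrableS it => //; exact: subset_itv_oc_cc.
  rewrite -Rintegral_itv_bndo_bndc; last first.
    by apply: integrableS it => //; exact: subset_itv_oo_cc.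
  apply: eq_Rintegral => s; rewrite inE => st; rewrite /h0 patchE mem_set//.
  exact: (subt t).
have mfin : (mu `]0%R, T[ < +oo)%E.
  by rewrite lebesgue_measure_itv/= lte_fin T0 ltry.
have [g [cg ig gh]] :=
  @approximation_continuous_integrable _ `]0, T[ h (measurable_itv _) mfin ih.
pose e n := \int[mu]_(t in `]0, T[) `|h t - g n t|.
have id n : mu.-integrable `]0, T[ (EFin \o (fun t => h t - g n t)).
  exact: (integrableB _ ih (ig n)).
have ie n : mu.-integrable `]0, T[ (EFin \o (fun t => `|h t - g n t|)).
  by have := integrable_abse (id n).
have e0 : e n @[n --> \oo] --> 0.
  exact: (fine_cvg gh).
exists P; split => // phi tphi.
have [cphi cphi' dphi _ _] := test_function_continuous tphi.
have [M1 M10 HM1] :=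
  continuous_bounded_itv (@continuous_subspaceT _ _ `[0, T] _ cphi).
have [M2 M20 HM2] :=
  continuous_bounded_itv (@continuous_subspaceT _ _ `[0, T] _ cphi').
set X := (LHS in LHS = _); set Y := \int[mu]_(t in `]0, T[) (phi t * h t).
suff bnd n : `|X + Y| <= (M2 * T + M1) * e n.
  apply/eqP; rewrite -addr_eq0 -normr_le0 -(mulr0 (M2 * T + M1)).
  have lhs : cst `|X + Y| n @[n --> \oo] --> `|X + Y| by exact: cvg_cst.
  have rhs : (M2 * T + M1) * e n @[n --> \oo] --> (M2 * T + M1) * 0.
    by apply: cvgM; [exact: cvg_cst|exact: e0].
  by apply: (ler_cvg_to lhs rhs); apply: nearW => n; exact: bnd.
have [G G0 dG] := continuous_antiderivative (cg n).
have cG := is_derive_continuous dG.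
have PG t : t \in `[0, T] -> `|P t - G t| <= e n.
  move=> tT; rewrite PE//; move: tT; rewrite in_itv/= => /andP[t0 tT].
  move: t0; rewrite le_eqVlt => /predU1P[<-|t0].
    rewrite set_itv_ge ?bnd_simp ?ltxx// Rintegral_set0 G0 subrr normr0.
    by apply: Rintegral_ge0 => *; exact: normr_ge0.
  have -> : G t = \int[mu]_(s in `]0, t[) g n s.
    by rewrite (Rintegral_oo_is_derive t0 (cg n) dG) G0 subr0.
  have iS k : mu.-integrable `]0, T[ (EFin \o k) ->
      mu.-integrable `]0, t[ (EFin \o k).
    by apply: integrableS => //; exact: subt.
  rewrite -RintegralB//; [|exact: iS|exact: (iS _ (ig n))].
  rewrite (le_trans (le_normr_Rintegral _ _))//; first exact: iS (id n).
  apply: fine_le.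
  - by apply: integrable_fin_num => //; exact: iS (ie n).
  - by apply: integrable_fin_num => //; exact: (ie n).
  apply: ge0_subset_integral => //; last exact: subt.
  by have /integrableP[] := ie n.
have cPG : {within `[0, T], continuous (fun t => P t - G t)}.
  apply/subspace_continuousP => t tT; apply: cvgB.
    by move/subspace_continuousP : cP; exact.
  by apply: cvg_within_filter; exact: cG.
have ioo k : {within `[0, T], continuous k} -> mu.-integrable `]0, T[ (EFin \o k).
  move=> ck; apply: (@integrableS _ _ _ mu `[0, T]) => //.
    exact: subset_itv_oo_cc.
  by apply: continuous_compact_integrable => //; exact: segment_compact.
have iG : mu.-integrable `]0, T[ (EFin \o G).
  by apply: ioo; exact: continuous_subspaceT.
have i1 := integrable_continuousM cphi' (ioo _ cP).
have i2 := integrable_continuousM cphi' iG.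
have i3 := integrable_continuousM cphi ih.
have i4 := integrable_continuousM cphi (ig n).
have i5 := integrable_continuousM cphi' (ioo _ cPG).
have i6 := integrable_continuousM cphi (id n).
have -> : X + Y = \int[mu]_(t in `]0, T[) (derive1 phi t * (P t - G t)) +
    \int[mu]_(t in `]0, T[) (phi t * (h t - g n t)).
  under [X in _ = X + _]eq_Rintegral do rewrite mulrBr.
  under [X in _ = _ + X]eq_Rintegral do rewrite mulrBr.
  rewrite RintegralB// RintegralB// (Rintegral_by_parts_test T0 tphi (cg n) dG).
  by rewrite opprK addrACA subrr addr0.
rewrite (le_trans (ler_normD _ _))// mulrDl; apply: lerD.
- rewrite (le_trans (le_normr_Rintegral _ i5))//.
  have icst : mu.-integrable `]0, T[ (EFin \o cst (M2 * e n)).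
    by apply: ioo; apply: continuous_subspaceT => ?; exact: cvg_cst.
  apply: (@le_trans _ _ (\int[mu]_(t in `]0, T[) (M2 * e n))).
    apply: le_Rintegral => //; first exact: integrable_abse i5.
    move=> t /= /subset_itv_oo_cc tT; rewrite normrM ler_pM//.
      exact: HM2.
    exact: PG.
  rewrite Rintegral_cst//= lebesgue_measure_itv/= lte_fin T0 /= subr0.
  by rewrite mulrAC.
- rewrite (le_trans (le_normr_Rintegral _ i6))//.
  rewrite -RintegralZl//; apply: le_Rintegral => //.
  + exact: integrable_abse i6.
  + exact: (integrable_continuousM (@cst_continuous _ _ M1) (ie n)).
  + by move=> t /= /subset_itv_oo_cc tT; rewrite normrM ler_wpM2r// HM1.
Qed.

End ScalarCalculus.

(** * Bochner square integrability and weak differentiability *)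

Section BochnerClosure.
Context {R : realType}.
Notation mu := (@lebesgue_measure R).

Definition bounded_linear {X Y : normedModType R} (L : X -> Y) : Prop :=
  linear L /\ exists C : R, forall x, `|L x| <= C * `|x|.

Lemma bounded_linear_continuous {X Y : normedModType R} (L : X -> Y) :
  bounded_linear L -> continuous L.
Proof.
move=> [lL [C hC]] x; apply/cvgrPdist_le => e e0.
have C0 : 0 < `|C| + 1 by rewrite ltr_pwDr.
near=> y.
have -> : L x - L y = L (x - y).
  have -> : x - y = -1 *: y + x by rewrite scaleN1r addrC.
  by rewrite lL scaleN1r addrC.
rewrite (le_trans (hC _))// (le_trans (ler_wpM2r _ (ler_norm C)))//.
rewrite (@le_trans _ _ ((`|C| + 1) * `|x - y|))// ?ler_wpM2r ?lerDl//.
rewrite -ler_pdivlMl// mulrC.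
by near: y; apply: cvgr_dist_le => //; rewrite divr_gt0.
Unshelve. all: by end_near. Qed.

(** The level sets are finite unions of intersections of level sets. *)
Lemma simple_function_op2 {X Y Z : normedModType R} (op : X -> Y -> Z)
    (s : R -> X) (s' : R -> Y) :
  simple_function s -> simple_function s' ->
  simple_function (fun t => op (s t) (s' t)).
Proof.
move=> [fs ms] [fs' ms']; split.
  apply: (@sub_finite_set _ _ ((fun z => op z.1 z.2) @` (range s `*` range s'))).
    by move=> _ [t _ <-]; exists (s t, s' t) => //=; split; exists t.
  by apply: finite_image; exact: finite_setX.
move=> z.
have -> : (fun t => op (s t) (s' t)) @^-1` [set z] =
    \bigcup_(xy in (range s `*` range s') `&` [set xy | op xy.1 xy.2 = z])
      (s @^-1` [set xy.1] `&` s' @^-1` [set xy.2]).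
  apply/seteqP; split=> [t /= tz|t [[x y] /= [_ <-] [-> ->//]]].
  by exists (s t, s' t) => //=; split => //; split; exists t.
apply: fin_bigcup_measurable => [|xy _]; last by apply: measurableI.
by apply: finite_setIl; exact: finite_setX.
Qed.

Lemma strongly_measurable_op2 {X Y Z : normedModType R} (op : X -> Y -> Z) D
    (u : R -> X) (v : R -> Y) :
  continuous (fun xy : X * Y => op xy.1 xy.2) ->
  strongly_measurable D u -> strongly_measurable D v ->
  strongly_measurable D (fun t => op (u t) (v t)).
Proof.
move=> cop [s [ss su]] [s' [ss' su']].
exists (fun n t => op (s n t) (s' n t)); split.
  by move=> n; exact: simple_function_op2.
move=> t Dt.
apply: (@cvg_comp _ _ _ (fun n => (s n t, s' n t)) (fun xy => op xy.1 xy.2)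
  _ (nbhs (u t, v t)) _ _ (cop (u t, v t))).
by apply: cvg_pair; [exact: su|exact: su'].
Qed.

Lemma strongly_measurable_comp {X Y : normedModType R} (L : X -> Y) D (u : R -> X) :
  continuous L -> strongly_measurable D u -> strongly_measurable D (L \o u).
Proof.
move=> cL mu'; apply: (@strongly_measurable_op2 _ _ _ (fun x _ => L x) D u u) => //.
by move=> [x y]; apply: continuous_comp; [exact: cvg_fst|exact: cL].
Qed.

Import HBSimple.

(** A pointwise limit of simple functions is measurable, and a measurable real
function is the pointwise limit of its simple approximations. *)
Lemma strongly_measurableP D (c : R -> R) : measurable D ->
  @strongly_measurable R R^o D c <-> measurable_fun D c.
Proof.
move=> mD; split=> [[s [ss sc]]|mc].
  apply: (measurable_fun_cvg _ sc) => n; apply: measurable_funTS.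
  have [fs ms] := ss n => _ A mA; rewrite setTI.
  have -> : s n @^-1` A = \bigcup_(x in range (s n) `&` A) (s n @^-1` [set x]).
    apply/seteqP; split=> [t /= At|t [x [_ Ax] /= ->//]].
    by exists (s n t) => //; split => //; exists t.
  apply: fin_bigcup_measurable => [|x _]; first exact: finite_setIl.
  exact: ms.
have [s sc] := @approximation_sfun _ R R (EFin \o c) D mD
  ((measurable_EFinP _ _).2 mc).
exists (fun n t => s n t); split.
  move=> n; split; first exact: fimfunP.
  by move=> x; rewrite -[X in measurable X]setTI; exact: measurable_funP.
by move=> t Dt; exact: (fine_cvg (sc t Dt)).
Qed.

Lemma measurable_norm {X : normedModType R} D (u : R -> X) : measurable D ->
  strongly_measurable D u -> measurable_fun D (fun t => `|u t|).
Proof.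
move=> mD mu'; apply/strongly_measurableP => //.
apply: (@strongly_measurable_comp X R^o (fun x => `|x|)) => //.
exact: norm_continuous.
Qed.

Lemma bochner_L2_le {X Y : normedModType R} T (u : R -> X) (v : R -> Y) (C : R) :
  strongly_measurable `]0, T[ v -> bochner_L2 T u ->
  (forall t, `|v t| ^+ 2 <= C * `|u t| ^+ 2) -> bochner_L2 T v.
Proof.
move=> mv [mu' u2] vu; split => //.
have nu := measurable_norm (measurable_itv _) mu'.
have nv := measurable_norm (measurable_itv _) mv.
have mu2 : measurable_fun `]0, T[ (EFin \o (fun t => `|u t| ^+ 2)).
  by apply/measurable_EFinP; exact: measurable_funX.
apply: (@le_lt_trans _ _ (\int[mu]_(t in `]0%R, T[)
    (`|C|%:E * (`|u t| ^+ 2)%:E))%E).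
  apply: ge0_le_integral => //.
  - by apply/measurable_EFinP; exact: measurable_funX.
  - exact: measurable_funeM mu2.
  - move=> t _; rewrite -EFinM lee_fin (le_trans (vu t))// ler_wpM2r ?exprn_ge0//.
    exact: ler_norm.
by rewrite ge0_integralZl// lte_mul_pinfty.
Qed.

Lemma bochner_L2_comp {X Y : normedModType R} T (L : X -> Y) (u : R -> X) :
  bounded_linear L -> bochner_L2 T u -> bochner_L2 T (L \o u).
Proof.
move=> bL u2; have [_ [C hC]] := bL.
apply: (@bochner_L2_le _ _ _ u _ (C ^+ 2)) => //.
  case: u2 => mu' _; apply: strongly_measurable_comp => //.
  exact: bounded_linear_continuous.
by move=> t /=; rewrite -exprMn lerXn2r// ?nnegrE// (le_trans _ (hC _)).
Qed.

Lemma bochner_L2D {X : normedModType R} T (u v : R -> X) :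
  bochner_L2 T u -> bochner_L2 T v -> bochner_L2 T (fun t => u t + v t).
Proof.
move=> [mu' u2] [mv v2].
have mw : strongly_measurable `]0, T[ (fun t => u t + v t).
  apply: strongly_measurable_op2 => //; exact: add_continuous.
split => //.
have nu := measurable_norm (measurable_itv _) mu'.
have nv := measurable_norm (measurable_itv _) mv.
have nw := measurable_norm (measurable_itv _) mw.
have mu2 : measurable_fun `]0, T[ (EFin \o (fun t => `|u t| ^+ 2)).
  by apply/measurable_EFinP; exact: measurable_funX.
have mv2 : measurable_fun `]0, T[ (EFin \o (fun t => `|v t| ^+ 2)).
  by apply/measurable_EFinP; exact: measurable_funX.
have muv := emeasurable_funD mu2 mv2.
apply: (@le_lt_trans _ _ (\int[mu]_(t in `]0%R, T[)
    (2%:E * ((`|u t| ^+ 2)%:E + (`|v t| ^+ 2)%:E)))%E).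
  apply: ge0_le_integral => //.
  - by apply/measurable_EFinP; exact: measurable_funX.
  - exact: measurable_funeM muv.
  - move=> t _; rewrite -EFinD -EFinM lee_fin.
    rewrite (@le_trans _ _ ((`|u t| + `|v t|) ^+ 2))//.
      by rewrite lerXn2r// ?nnegrE// ?ler_normD// addr_ge0.
    rewrite -subr_ge0 [leRHS](_ : _ = (`|u t| - `|v t|) ^+ 2) ?sqr_ge0//.
    by ring.
rewrite ge0_integralZl//; last first.
  by move=> t _; rewrite -EFinD lee_fin addr_ge0// exprn_ge0.
rewrite ge0_integralD//.
by rewrite lte_mul_pinfty// lte_add_pinfty.
Qed.

(** [(0, T)] has finite measure and [`|c| <= 1 + c ^+ 2]. *)
Lemma bochner_L2_integrable T (c : R -> R) : @bochner_L2 R R^o T c ->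
  mu.-integrable `]0, T[ (EFin \o c).
Proof.
move=> [/strongly_measurableP mc c2]; have {}mc := mc (measurable_itv _).
have i2 : mu.-integrable `]0, T[ (EFin \o (fun t => c t ^+ 2)).
  apply/integrableP; split.
    by apply/measurable_EFinP; exact: measurable_funX.
  rewrite (le_lt_trans _ c2)//.
  under eq_integral => t _ do rewrite /= normrX.
  exact: lexx.
have i1 : mu.-integrable `]0, T[ (EFin \o cst (1 : R)).
  apply: (@continuous_integrable_itv _ `]0, T[ 0 T).
    exact: subset_itv_oo_cc.
  exact: cst_continuous.
have i12 : mu.-integrable `]0, T[
    ((EFin \o cst (1 : R)) \+ (EFin \o (fun t => c t ^+ 2))).
  exact: integrableD.
apply: le_integrable i12 => //; first exact/measurable_EFinP.
move=> t _; rewrite /= lee_fin.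
rewrite [leRHS]ger0_norm ?addr_ge0 ?sqr_ge0//.
rewrite -real_normK ?num_real//.
have [c1|/ltW c1] := leP `|c t| 1; first by rewrite (le_trans c1)// lerDl sqr_ge0.
by rewrite (@le_trans _ _ (`|c t| ^+ 2)) ?lerDr// expr2 ler_peMl.
Qed.

Lemma continuous_bochner_L2 T (c : R -> R) : {within `[0, T], continuous c} ->
  @bochner_L2 R R^o T c.
Proof.
move=> cc; split.
  apply/strongly_measurableP; first exact: measurable_itv.
  apply: (@measurable_funS _ _ _ _ `[0, T]) => //.
    exact: subset_itv_oo_cc.
  by apply: subspace_continuous_measurable_fun.
have c2 : mu.-integrable `[0, T] (EFin \o (fun t => c t * c t)).
  apply: continuous_compact_integrable; first exact: segment_compact.
  apply/subspace_continuousP => t tT.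
  by apply: cvgM; move/subspace_continuousP : cc; exact.
have {c2} : mu.-integrable `]0, T[ (EFin \o (fun t => c t ^+ 2)).
  by apply: integrableS c2 => //; exact: subset_itv_oo_cc.
move=> /integrableP[_]; apply: le_lt_trans.
under [leRHS]eq_integral => t _ do rewrite /= normrX.
exact: lexx.
Qed.

Lemma test_integrable T phi (c : R -> R) : test_function T phi ->
  @bochner_L2 R R^o T c ->
  mu.-integrable `]0, T[ (EFin \o (fun t => phi t * c t)) /\
  mu.-integrable `]0, T[ (EFin \o (fun t => derive1 phi t * c t)).
Proof.
move=> /test_function_continuous[cphi cphi' _ _ _] /bochner_L2_integrable ic.
by split; exact: integrable_continuousM.
Qed.

Lemma dual_bounded_linear {X : normedModType R} (l : dual X) :
  @bounded_linear X R^o l.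
Proof. by split; [exact: dual_linear|exact: dual_bounded]. Qed.

Lemma dual_of_subproof {X : normedModType R} (l : X -> R^o) :
  bounded_linear l -> l \in @bounded_functional_pred R X.
Proof. by move=> bl; apply/asboolP. Qed.

Definition dual_of {X : normedModType R} (l : X -> R^o)
    (bl : bounded_linear l) : dual X :=
  Dual (dual_of_subproof bl).

Lemma bounded_linear_comp {X Y Z : normedModType R} (L : X -> Y) (L' : Y -> Z) :
  bounded_linear L -> bounded_linear L' -> bounded_linear (L' \o L).
Proof.
move=> [lL [C hC]] [lL' [C' hC']]; split; first by move=> a x y /=; rewrite lL lL'.
exists (`|C'| * C) => x /=; rewrite (le_trans (hC' _))// -mulrA.
rewrite (le_trans (ler_wpM2r _ (ler_norm C')))// ler_wpM2l//.
Qed.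

(** A functional composed with [L] is a functional, so that [L] commutes with
weak derivation. *)
Lemma H1_comp {X Y : normedModType R} T (S : set X) (S' : set Y) (L : X -> Y)
    (u du : R -> X) :
  bounded_linear L -> (forall x, S x -> S' (L x)) ->
  H1_with_derivative T S u du -> H1_with_derivative T S' (L \o u) (L \o du).
Proof.
move=> bL SS' [cu Su Sdu [u2 du2] wu]; split.
- apply/subspace_continuousP => t tT.
  apply: (@cvg_comp _ _ _ u L _ (nbhs (u t))).
    by move/subspace_continuousP : cu; exact.
  change (L x @[x --> u t] --> L (u t)); exact: bounded_linear_continuous.
- by move=> t tT; exact/SS'/Su.
- by move=> t tT; exact/SS'/Sdu.
- by split; exact: bochner_L2_comp.
- move=> l.
  exact: (wu (dual_of (bounded_linear_comp bL (dual_bounded_linear l)))).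
Qed.

Lemma H1D {X : normedModType R} T (S : set X) (u du v dv : R -> X) :
  (forall x y, S x -> S y -> S (x + y)) ->
  H1_with_derivative T S u du -> H1_with_derivative T S v dv ->
  H1_with_derivative T S (fun t => u t + v t) (fun t => du t + dv t).
Proof.
move=> SD [cu Su Sdu [u2 du2] wu] [cv Sv Sdv [v2 dv2] wv]; split.
- apply/subspace_continuousP => t tT; apply: cvgD.
    by move/subspace_continuousP : cu; exact.
  by move/subspace_continuousP : cv; exact.
- by move=> t tT; apply: SD; [exact: Su|exact: Sv].
- by move=> t tT; apply: SD; [exact: Sdu|exact: Sdv].
- by split; exact: bochner_L2D.
- move=> l phi tphi; have bl := dual_bounded_linear l.
  have lD x y : l (x + y) = l x + l y.
    by have := dual_linear l 1 x y; rewrite !scale1r.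
  have [_ iu] := test_integrable tphi (bochner_L2_comp bl u2).
  have [_ iv] := test_integrable tphi (bochner_L2_comp bl v2).
  have [idu _] := test_integrable tphi (bochner_L2_comp bl du2).
  have [idv _] := test_integrable tphi (bochner_L2_comp bl dv2).
  under eq_Rintegral do rewrite lD mulrDr.
  under [in RHS]eq_Rintegral do rewrite lD mulrDr.
  by rewrite RintegralD// RintegralD// wu// wv// opprD.
Qed.

(** As [R]-linear functionals on [R] are multiplications, the weak derivative
of a real function may be tested without functionals. *)
Lemma H1_scalarI T (c dc : R -> R) : {within `[0, T], continuous c} ->
  @bochner_L2 R R^o T dc ->
  (forall phi, test_function T phi ->
    \int[mu]_(t in `]0, T[) (derive1 phi t * c t) =
    - \int[mu]_(t in `]0, T[) (phi t * dc t)) ->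
  @H1_with_derivative R R^o T setT c dc.
Proof.
move=> cc dc2 w; have c2 := continuous_bochner_L2 cc.
split => // l phi tphi.
have lE (x : R) : l x = x * l 1.
  have := dual_linear l x 1 0.
  have -> : l 0 = 0.
    have := dual_linear l 1 0 0; rewrite !scale1r addr0 => /eqP.
    by rewrite -subr_eq0 opprD addNKr oppr_eq0 => /eqP.
  rewrite !addr0 => lx; rewrite -[RHS]/(x *: l 1) -lx; congr (l _).
  exact/esym/mulr1.
have [_ ic] := test_integrable tphi c2.
have [idc _] := test_integrable tphi dc2.
under eq_Rintegral do rewrite lE mulrA.
under [in RHS]eq_Rintegral do rewrite lE mulrA.
by rewrite RintegralZr// RintegralZr// w// mulNr.
Qed.

Lemma scale_bounded_linear {X : normedModType R} (x : X) :
  @bounded_linear R^o X (fun c => c *: x).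
Proof.
split; first by move=> a c d; rewrite scalerDl scalerA.
by exists `|x| => c; rewrite normrZ mulrC.
Qed.

Lemma H1_sum {X : normedModType R} T (S : set X) n (u du : 'I_n -> R -> X) :
  S 0 -> (forall x y, S x -> S y -> S (x + y)) ->
  (forall i, H1_with_derivative T S (u i) (du i)) ->
  H1_with_derivative T S (fun t => \sum_i u i t) (fun t => \sum_i du i t).
Proof.
move=> S0 SD; elim: n u du => [|n IH] u du hu.
  have h0 : @H1_with_derivative R R^o T setT (cst 0) (cst 0).
    have c0 : {within `[0, T], continuous (cst (0 : R))}.
      by apply: continuous_subspaceT; exact: cst_continuous.
    apply: H1_scalarI => //; first exact: continuous_bochner_L2.
    move=> phi _; under eq_Rintegral do rewrite mulr0.
    under [in RHS]eq_Rintegral do rewrite mulr0.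
    by rewrite Rintegral_cst//= mul0r oppr0.
  have := H1_comp (scale_bounded_linear (0 : X)) (S' := S) _ h0.
  have big0 : (fun t : R => \sum_(i < 0) u i t) =
      (fun c : R^o => c *: (0 : X)) \o cst 0.
    by apply/funext => t; rewrite big_ord0 /= scaler0.
  have dbig0 : (fun t : R => \sum_(i < 0) du i t) =
      (fun c : R^o => c *: (0 : X)) \o cst 0.
    by apply/funext => t; rewrite big_ord0 /= scaler0.
  by rewrite big0 dbig0; apply => c _; rewrite scaler0.
have -> : (fun t => \sum_(i < n.+1) u i t) =
    (fun t => u ord0 t + \sum_(i < n) u (lift ord0 i) t).
  by apply/funext => t; rewrite big_ord_recl.
have -> : (fun t => \sum_(i < n.+1) du i t) =
    (fun t => du ord0 t + \sum_(i < n) du (lift ord0 i) t).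
  by apply/funext => t; rewrite big_ord_recl.
exact: H1D SD (hu _) (IH (fun i => u (lift ord0 i))
  (fun i => du (lift ord0 i)) (fun i => hu _)).
Qed.

Lemma H1_scalarW T S (c dc : R -> R) phi :
  @H1_with_derivative R R^o T S c dc -> test_function T phi ->
  \int[mu]_(t in `]0, T[) (derive1 phi t * c t) =
  - \int[mu]_(t in `]0, T[) (phi t * dc t).
Proof.
move=> [_ _ _ _ w] tphi.
have bid : @bounded_linear R^o R^o id by split => //; exists 1 => x; rewrite mul1r.
exact: (w (dual_of bid)).
Qed.

End BochnerClosure.

(** * Bilinear forms on finite dimensional subspaces *)

Section LinearCombinations.
Context {R : realType}.

Definition lincomb {X : normedModType R} n (e : 'I_n -> X) (c : 'cV[R]_n) : X :=
  \sum_i c i 0 *: e i.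

Lemma lincombD {X : normedModType R} n (e : 'I_n -> X) c d :
  lincomb e (c + d) = lincomb e c + lincomb e d.
Proof.
by rewrite /lincomb -big_split /=; apply: eq_bigr => i _; rewrite mxE scalerDl.
Qed.

Lemma lincomb0 {X : normedModType R} n (e : 'I_n -> X) : lincomb e 0 = 0.
Proof. by rewrite /lincomb big1// => i _; rewrite mxE scale0r. Qed.

Context {X : normedModType R} {S : set X} {n : nat} {e : 'I_n -> X}.
Context (basis_e : is_basis S e).

Lemma lincomb_in c : S (lincomb e c).
Proof. by apply/(proj1 basis_e); exists (fun i => c i 0). Qed.

Lemma basis_in i : S (e i).
Proof.
apply/(proj1 basis_e); exists (fun j => (j == i)%:R).
by rewrite (bigD1 i)//= eqxx scale1r big1 ?addr0// => j /negPf ->; rewrite scale0r.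
Qed.

Lemma lincombP x : S x -> exists c, x = lincomb e c.
Proof.
move=> /(proj1 basis_e)[c ->]; exists (\col_i c i).
by apply: eq_bigr => i _; rewrite mxE.
Qed.

Lemma lincomb_inj0 c : lincomb e c = 0 -> c = 0.
Proof. by move=> /(proj2 basis_e) c0; apply/colP => i; rewrite mxE c0. Qed.

Lemma basis_add x y : S x -> S y -> S (x + y).
Proof.
by move=> /lincombP[c ->] /lincombP[d ->]; rewrite -lincombD; exact: lincomb_in.
Qed.

Lemma basis_scale (r : R) x : S x -> S (r *: x).
Proof.
move=> /lincombP[c ->]; rewrite (_ : _ *: _ = lincomb e (r *: c)).
  exact: lincomb_in.
by rewrite /lincomb scaler_sumr; apply: eq_bigr => i _; rewrite mxE scalerA.
Qed.

Lemma basis0 : S 0.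
Proof. by rewrite -(lincomb0 e); exact: lincomb_in. Qed.

End LinearCombinations.

Section FormMatrices.
Context {R : realType}.

Lemma form_sumlz {X Y : normedModType R} (c : {bilinear X -> Y -> R | *%R & *%R}) n
    (e : 'I_n -> X) (x : 'cV[R]_n) y :
  c (lincomb e x) y = \sum_i x i 0 * c (e i) y.
Proof. by rewrite linear_sumlz; apply: eq_bigr => i _; rewrite linearZl_LR. Qed.

Lemma form_sumr {X Y : normedModType R} (c : {bilinear X -> Y -> R | *%R & *%R}) n
    (e : 'I_n -> Y) (y : 'cV[R]_n) x :
  c x (lincomb e y) = \sum_i y i 0 * c x (e i).
Proof. by rewrite linear_sumr; apply: eq_bigr => i _; rewrite linearZr_LR. Qed.

Lemma form_boundedl {X : normedModType R}
    (c : {bilinear X -> X -> R | *%R & *%R}) y :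
  bounded_elliptic_symmetric c -> @bounded_linear R X R^o (fun x => c x y).
Proof.
move=> [[C hC] _ _]; split; first by move=> r x x'; rewrite linearPl.
by exists (C * `|y|) => x; rewrite mulrAC; exact: hC.
Qed.

Lemma elliptic_definite {X : normedModType R}
    (c : {bilinear X -> X -> R | *%R & *%R}) x :
  bounded_elliptic_symmetric c -> c x x <= 0 -> x = 0.
Proof.
move=> [_ [alpha al0 hal] _] cx; apply/normr0_eq0/eqP.
rewrite -sqrf_eq0 eq_le sqr_ge0 andbT -(pmulr_rle0 _ al0).
exact: le_trans (hal x) cx.
Qed.

Lemma dual_lincomb {X : normedModType R} n (e : 'I_n -> X) (f : dual X) z :
  f (lincomb e z) = \sum_i z i 0 * f (e i).
Proof.
have fD u v : f (u + v) = f u + f v.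
  by have := dual_linear f 1 u v; rewrite !scale1r.
have f0 : f 0 = 0 by apply: (@addIr _ (f 0)); rewrite -fD !add0r.
have fZ r u : f (r *: u) = r * f u.
  by have := dual_linear f r u 0; rewrite f0 !addr0.
by rewrite /lincomb; elim/big_rec2: _ => [//|i r s _ <-]; rewrite fD fZ.
Qed.

Context {V Q Q0 : normedModType R} (emb : {linear Q -> Q0}).
Context (a : {bilinear V -> V -> R | *%R & *%R}).
Context (k : {bilinear Q -> Q -> R | *%R & *%R}).
Context (b : {bilinear V -> Q0 -> R | *%R & *%R}).
Context (n m : nat) (phi : 'I_n -> V) (psi : 'I_m -> Q).

Local Notation A := (a_matrix a phi).
Local Notation K := (k_matrix k psi).
Local Notation B := (b_matrix emb b phi psi).

Lemma a_matrixE x i : (A *m x) i 0 = a (lincomb phi x) (phi i).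
Proof. by rewrite form_sumlz mxE; apply: eq_bigr => j _; rewrite mxE mulrC. Qed.

Lemma k_matrixE y i : (K *m y) i 0 = k (lincomb psi y) (psi i).
Proof. by rewrite form_sumlz mxE; apply: eq_bigr => j _; rewrite mxE mulrC. Qed.

Lemma b_matrixE x i : (B *m x) i 0 = b (lincomb phi x) (emb (psi i)).
Proof. by rewrite form_sumlz mxE; apply: eq_bigr => j _; rewrite mxE mulrC. Qed.

Lemma emb_lincomb y : emb (lincomb psi y) = lincomb (emb \o psi) y.
Proof. by rewrite linear_sum; apply: eq_bigr => i _; rewrite linearZ. Qed.

Lemma b_matrix_trE y j : (B^T *m y) j 0 = b (phi j) (emb (lincomb psi y)).
Proof.
rewrite emb_lincomb form_sumr mxE.
by apply: eq_bigr => i _; rewrite !mxE mulrC.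
Qed.

Lemma a_matrix_quad x : (x^T *m A *m x) 0 0 = a (lincomb phi x) (lincomb phi x).
Proof.
by rewrite form_sumr -mulmxA mxE; apply: eq_bigr => i _; rewrite mxE a_matrixE.
Qed.

Lemma k_matrix_quad y : (y^T *m K *m y) 0 0 = k (lincomb psi y) (lincomb psi y).
Proof.
by rewrite form_sumr -mulmxA mxE; apply: eq_bigr => i _; rewrite mxE k_matrixE.
Qed.

Lemma b_matrix_quad x y :
  (y^T *m (B *m x)) 0 0 = b (lincomb phi x) (emb (lincomb psi y)).
Proof.
rewrite emb_lincomb form_sumr mxE.
by apply: eq_bigr => i _; rewrite mxE b_matrixE.
Qed.

Context (Vh : set V) (Qh : set Q).
Context (basis_phi : is_basis Vh phi) (basis_psi : is_basis Qh psi).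
Context (A1 : bounded_elliptic_symmetric a) (A2 : bounded_elliptic_symmetric k).

Lemma a_matrix_definite : definite_mx A.
Proof.
move=> x; rewrite a_matrix_quad => /(elliptic_definite A1).
exact: lincomb_inj0 basis_phi _.
Qed.

Lemma k_matrix_definite : definite_mx K.
Proof.
move=> x; rewrite k_matrix_quad => /(elliptic_definite A2).
exact: lincomb_inj0 basis_psi _.
Qed.

Lemma first_equationE x y (f : dual V) :
  first_equation emb a b Vh (lincomb phi x) (lincomb psi y) f <->
  A *m x - B^T *m y = \col_i f (phi i).
Proof.
split=> [h|h v /(lincombP basis_phi)[z ->]].
  apply/colP => i; rewrite !mxE -h; last exact: basis_in basis_phi i.
  by rewrite -a_matrixE -b_matrix_trE !mxE.
rewrite form_sumr form_sumlz -sumrB dual_lincomb.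
apply: eq_bigr => i _; have /colP/(_ i) := h; rewrite [RHS]mxE => <-.
by rewrite -mulrBr -a_matrixE -b_matrix_trE !mxE.
Qed.

Lemma second_equationE (du : V) x y (g : dual Q) : du = lincomb phi x ->
  second_equation emb k b Qh du (lincomb psi y) g <->
  B *m x + K *m y = \col_i g (psi i).
Proof.
move=> ->; split=> [h|h q /(lincombP basis_psi)[z ->]].
  apply/colP => i; rewrite !mxE -h; last exact: basis_in basis_psi i.
  by rewrite -b_matrixE -k_matrixE !mxE.
rewrite emb_lincomb !form_sumr -big_split dual_lincomb /=.
apply: eq_bigr => i _; have /colP/(_ i) := h; rewrite [RHS]mxE => <-.
by rewrite -mulrDr -b_matrixE -k_matrixE !mxE.
Qed.

End FormMatrices.

(** * The discrete inf-sup condition *)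

Section InfSup.
Context {R : realType} {V Q Q0 : normedModType R} (emb : {linear Q -> Q0}).
Context (a : {bilinear V -> V -> R | *%R & *%R}).
Context (k : {bilinear Q -> Q -> R | *%R & *%R}).
Context (b : {bilinear V -> Q0 -> R | *%R & *%R}).
Context (n m : nat) (phi : 'I_n -> V) (psi : 'I_m -> Q).
Context (Vh : set V) (Qh : set Q).
Context (basis_phi : is_basis Vh phi) (basis_psi : is_basis Qh psi).
Context (A1 : bounded_elliptic_symmetric a) (A2 : bounded_elliptic_symmetric k).
Context (emb_inj : injective emb) (b_bounded : bounded_form a b).
Context (normQ0 : forall q : Q, `|emb q| <= energy_norm k q).

Local Notation A := (a_matrix a phi).
Local Notation K := (k_matrix k psi).
Local Notation B := (b_matrix emb b phi psi).

Lemma energy_norm_le {X : normedModType R}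
    (c : {bilinear X -> X -> R | *%R & *%R}) :
  bounded_elliptic_symmetric c ->
  exists2 C, 0 <= C & forall x, energy_norm c x <= C * `|x|.
Proof.
move=> [[C hC] _ _]; exists (Num.sqrt `|C|) => // x.
have -> : `|x| = Num.sqrt (`|x| ^+ 2) by rewrite sqrtr_sqr normr_id.
rewrite /energy_norm -sqrtrM// ler_sqrt ?mulr_ge0 ?sqr_ge0//.
rewrite (le_trans (ler_norm _))// (le_trans (hC _ _))// -mulrA -expr2.
by rewrite ler_wpM2r ?sqr_ge0// ler_norm.
Qed.

(** The bound on [b] is one-sided and is applied to [q] and to [- q]. *)
Lemma form_b_norm : exists2 Cb, 0 < Cb &
  forall v q, `|b v q| <= Cb * energy_norm a v * `|q|.
Proof.
have [Cb Cb0 hb] := b_bounded; exists Cb => // v q.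
by rewrite ler_norml hb andbT lerNl -linearNr -(normrN q) hb.
Qed.

Lemma form_b_boundedl q : @bounded_linear R V R^o (fun v => b v q).
Proof.
split; first by move=> r x x'; rewrite linearPl.
have [Cb Cb0 hb] := form_b_norm; have [C C0 hC] := energy_norm_le A1.
exists (Cb * C * `|q|) => v; rewrite (le_trans (hb _ _))// [leRHS]mulrAC.
by rewrite ler_wpM2r// -mulrA ler_wpM2l ?hC// ltW.
Qed.

Lemma form_b_emb_boundedr v : @bounded_linear R Q R^o (fun q => b v (emb q)).
Proof.
split; first by move=> r q q'; rewrite linearP linearPr.
have [Cb Cb0 hb] := form_b_norm; have [C C0 hC] := energy_norm_le A2.
exists (Cb * energy_norm a v * C) => q; rewrite (le_trans (hb _ _))// -[leRHS]mulrA.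
rewrite ler_wpM2l//; first by rewrite mulr_ge0 ?sqrtr_ge0 ?ltW.
exact: le_trans (normQ0 q) (hC q).
Qed.

Lemma definite_mx1 p : definite_mx (1%:M : 'M[R]_p).
Proof.
move=> x; rewrite mulmx1 mxE => x0.
have x2 i : true -> 0 <= x^T 0 i * x i 0 by rewrite mxE -expr2 sqr_ge0.
have x00 : \sum_i x^T 0 i * x i 0 = 0 by apply/eqP; rewrite eq_le x0 sumr_ge0.
apply/colP => i; have /eqP : x^T 0 i * x i 0 = 0 by exact: (psumr_eq0P x2 x00).
by rewrite !mxE mulf_eq0 orbb => /eqP.
Qed.

(** If [B^T *m y = 0], then [b v q = 0] on [Vh] for the [q] with coordinates [y],
and the supremum in the inf-sup condition is zero, be it over an empty set. *)
Lemma infsup_stable_ker0 : infsup_stable a b Vh (emb @` Qh) ->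
  forall y : 'cV[R]_m, B^T *m y = 0 -> y = 0.
Proof.
move=> [beta beta0 h] y By; apply: (lincomb_inj0 basis_psi); apply: emb_inj.
rewrite [RHS]linear0; apply/normr0_eq0/eqP.
rewrite eq_le normr_ge0 andbT -(pmulr_rle0 _ beta0).
apply: (le_trans (h _ _)); first by exists (lincomb psi y) => //; exact: lincomb_in.
set E := [set _ | _ in _].
have E0 x : E x -> x = 0.
  move=> [v [/(lincombP basis_phi)[c ->] _] <-].
  by rewrite -b_matrix_quad -dot_mulmx By mulmx0 mxE.
have [->|/set0P E_neq0] := eqVneq E set0; first by rewrite sup0.
by apply: ge_sup => // x /E0 ->.
Qed.

Lemma quad_le_dot p (N : 'M[R]_p) : exists2 C, 0 < C &
  forall y : 'cV[R]_p, (y^T *m N *m y) 0 0 <= C * (y^T *m y) 0 0.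
Proof.
exists (\sum_i \sum_j `|N i j| + 1) => [|y].
  by rewrite ltr_wpDl// sumr_ge0// => ? _; exact: sumr_ge0.
have dotE : (y^T *m y) 0 0 = \sum_i y i 0 ^+ 2.
  by rewrite mxE; apply: eq_bigr => i _; rewrite mxE.
have dot_ge0 : 0 <= (y^T *m y) 0 0.
  by rewrite dotE sumr_ge0// => ? _; exact: sqr_ge0.
have le_dot i : y i 0 ^+ 2 <= (y^T *m y) 0 0.
  by rewrite dotE (bigD1 i)//= lerDl sumr_ge0// => ? _; exact: sqr_ge0.
have le_dot2 i j : `|y i 0 * y j 0| <= (y^T *m y) 0 0.
  rewrite normrM; have [ij|/ltW ij] := leP `|y i 0| `|y j 0|.
    by rewrite (le_trans _ (le_dot j))// -real_normK ?num_real// expr2 ler_wpM2r.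
  by rewrite (le_trans _ (le_dot i))// -real_normK ?num_real// expr2 ler_wpM2l.
rewrite mulrDl mul1r ler_wpDr// -mulmxA mxE mulr_suml ler_sum// => i _.
rewrite mulr_suml mxE [X in _ * X]mxE mulr_sumr ler_sum// => j _.
rewrite mulrCA (le_trans (ler_norm _))// normrM ler_wpM2l//.
Qed.

(** A right inverse [X] of the matrix [B] provides for [q], with coordinates [y],
a test function [v], with coordinates [X *m y], such that [b v q] is the squared
Euclidean norm of [y]; on a finite dimensional space this norm controls those of
[v] and [q]. *)
Lemma ker0_infsup_stable : (forall y : 'cV[R]_m, B^T *m y = 0 -> y = 0) ->
  infsup_stable a b Vh (emb @` Qh).
Proof.
move=> B0.
have uBB := definite_mx_unit (definite_mx_schur (@definite_mx1 n) B0).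
pose X := invmx 1%:M *m B^T *m invmx (B *m invmx 1%:M *m B^T).
have BX : B *m X = 1%:M by rewrite /X !mulmxA mulmxV.
have [C1 C10 h1] := quad_le_dot (X^T *m A *m X).
have [C2 C20 h2] := quad_le_dot K.
exists (Num.sqrt C1 * Num.sqrt C2)^-1.
  by rewrite invr_gt0 mulr_gt0// sqrtr_gt0.
move=> _ [_ /(lincombP basis_psi)[y ->] <-].
set E := [set _ | _ in _].
have ubE : has_ubound E.
  have [Cb Cb0 hb] := b_bounded.
  exists (Cb * `|emb (lincomb psi y)|) => _ [v [_ v1] <-].
  by rewrite (le_trans (hb _ _))// v1 mulr1.
have [y0|y0] := eqVneq y 0.
  rewrite y0 lincomb0 linear0 normr0 mulr0.
  have [E0|/set0P[x Ex]] := eqVneq E set0; first by rewrite E0 sup0.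
  have <- : x = 0 by case: Ex => v _ <-; rewrite y0 lincomb0 linear0 linear0r.
  exact: ub_le_sup.
set s := (y^T *m y) 0 0.
pose v := lincomb phi (X *m y).
have bvq : b v (emb (lincomb psi y)) = s.
  by rewrite -b_matrix_quad (mulmxA B) BX mul1mx.
have avv : a v v <= C1 * s.
  by rewrite -a_matrix_quad trmx_mul; have := h1 y; rewrite !mulmxA.
have s0 : 0 < s.
  rewrite ltNge; apply/negP => s0; move/eqP: y0; apply.
  by apply: definite_mx1; rewrite mulmx1.
have av0 : 0 < a v v.
  rewrite ltNge; apply/negP => /(elliptic_definite A1) v0.
  by move: s0; rewrite -bvq v0 linear0l ltxx.
have ev0 : 0 < energy_norm a v by rewrite sqrtr_gt0.
apply: (@le_trans _ _ (b ((energy_norm a v)^-1 *: v)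
    (emb (lincomb psi y)))); last first.
  apply: ub_le_sup => //; exists ((energy_norm a v)^-1 *: v) => //; split.
    by apply: (basis_scale basis_phi); exact: lincomb_in basis_phi _.
  rewrite /= {1}/energy_norm linearZl_LR linearZr_LR mulrA -expr2.
  rewrite sqrtrM ?sqr_ge0// sqrtr_sqr ger0_norm ?invr_ge0 ?(ltW ev0)//.
  by rewrite -/(energy_norm a v) mulVf// gt_eqF.
rewrite linearZl_LR bvq ler_pdivrMl; last by rewrite mulr_gt0// sqrtr_gt0.
rewrite /= mulrCA ler_pdivlMl//.
have sE : s = Num.sqrt s * Num.sqrt s by rewrite -expr2 sqr_sqrtr// ltW.
rewrite [leRHS](_ : _ = (Num.sqrt C1 * Num.sqrt s) * (Num.sqrt C2 * Num.sqrt s)).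
  apply: ler_pM => //; first exact: ltW.
    by rewrite -(sqrtrM _ (ltW C10)) /energy_norm ler_sqrt// mulr_ge0// ltW.
  rewrite (le_trans (normQ0 _))// /energy_norm -(sqrtrM _ (ltW C20)) ler_sqrt.
    by rewrite -k_matrix_quad h2.
  by rewrite mulr_ge0// ltW.
by rewrite {1}sE mulrACA.
Qed.

End InfSup.

(** * Weak solutions of the algebraic-differential system in coordinates *)

Section ColumnH1.
Context {R : realType}.
Notation mu := (@lebesgue_measure R).

Definition col_H1 p T (c c' : R -> 'cV[R]_p) : Prop :=
  forall i, @H1_with_derivative R R^o T setT (fun t => c t i 0) (fun t => c' t i 0).

Lemma H1_lincomb {X : normedModType R} T (S : set X) n (e : 'I_n -> X) c c' :
  is_basis S e -> col_H1 T c c' ->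
  H1_with_derivative T S (fun t => lincomb e (c t)) (fun t => lincomb e (c' t)).
Proof.
move=> be hc; apply: H1_sum => [||i]; [exact: basis0 be|exact: basis_add be|].
apply: H1_comp (scale_bounded_linear (e i)) _ (hc i) => r _.
by apply: (basis_scale be); exact: basis_in be i.
Qed.

Lemma H1B {X : normedModType R} T (S : set X) n (e : 'I_n -> X) u du v dv :
  is_basis S e -> H1_with_derivative T S u du -> H1_with_derivative T S v dv ->
  H1_with_derivative T S (fun t => u t - v t) (fun t => du t - dv t).
Proof.
move=> be hu hv.
have bN : @bounded_linear R X X (fun x => -1 *: x).
  split; first by move=> r x y; rewrite scalerDr !scalerA mulrC.
  by exists 1 => x; rewrite scaleN1r normrN mul1r.
have BE (w z : R -> X) : (fun t => w t - z t) = (fun t => w t + -1 *: z t).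
  by apply/funext => t; rewrite scaleN1r.
rewrite !BE; apply: H1D (basis_add be) hu (H1_comp bN _ hv) => x.
exact: basis_scale be _ _.
Qed.

Lemma col_H1_mul p q T (N : 'M[R]_(q, p)) c c' : col_H1 T c c' ->
  col_H1 T (fun t => N *m c t) (fun t => N *m c' t).
Proof.
move=> hc i.
have NE (d : R -> 'cV[R]_p) : (fun t => (N *m d t) i 0) =
    (fun t => \sum_j (fun r : R^o => r *: (N i j : R^o)) (d t j 0)).
  by apply/funext => t; rewrite mxE; apply: eq_bigr => j _; exact: mulrC.
rewrite !NE; apply: H1_sum => // j.
exact: H1_comp (scale_bounded_linear (N i j : R^o)) _ (hc j).
Qed.

Lemma col_H1D p T (c c' d d' : R -> 'cV[R]_p) : col_H1 T c c' -> col_H1 T d d' ->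
  col_H1 T (fun t => c t + d t) (fun t => c' t + d' t).
Proof.
move=> hc hd i.
have DE (e f : R -> 'cV[R]_p) :
    (fun t => (e t + f t) i 0) = (fun t => (e t i 0 : R^o) + f t i 0).
  by apply/funext => t; rewrite mxE.
by rewrite !DE; apply: H1D.
Qed.

Lemma col_H1_classical p T (y w : R -> 'cV[R]_p) : 0 < T ->
  (forall i, continuous (fun t => w t i 0)) -> (forall t, mx_is_derive y t (w t)) ->
  col_H1 T y w.
Proof.
move=> T0 cw dy i; have dyi t := dy t i 0.
have cy := is_derive_continuous dyi.
apply: H1_scalarI; first exact: continuous_subspaceT.
  by apply: continuous_bochner_L2; exact: continuous_subspaceT.
by move=> phi tphi; exact: Rintegral_by_parts_test.
Qed.

Lemma mx_is_derive_cst p q (v : 'M[R]_(p, q)) t : mx_is_derive (fun=> v) t 0.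
Proof. by move=> i j; rewrite mxE; exact: is_derive_cst. Qed.

Lemma col_H1_cst p T (v : 'cV[R]_p) : 0 < T -> col_H1 T (fun=> v) (fun=> 0).
Proof.
move=> T0; apply: col_H1_classical => // [i|t]; last exact: mx_is_derive_cst.
exact: cst_continuous.
Qed.

Lemma continuous_mulmx p q (N : 'M[R]_(q, p)) (w : R -> 'cV[R]_p) :
  (forall i, continuous (fun t => w t i 0)) ->
  forall i, continuous (fun t => (N *m w t) i 0).
Proof.
move=> cw i.
have -> : (fun t => (N *m w t) i 0) = (fun t => \sum_l N i l * w t l 0).
  by apply/funext => t; rewrite mxE.
apply: continuous_big => [|l _ t]; first by move=> ?; exact: add_continuous.
by apply: continuousM; [exact: cvg_cst|exact: cw].
Qed.

Lemma col_continuous_extension p T (w : R -> 'cV[R]_p) : 0 < T ->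
  (forall i, {within `[0, T], continuous (fun t => w t i 0)}) ->
  exists2 w' : R -> 'cV[R]_p, forall i, continuous (fun t => w' t i 0) &
    forall t, t \in `[0, T] -> w' t = w t.
Proof.
move=> T0 cw.
have /choice[z zP] : forall i, exists z, continuous z /\
    forall t, t \in `[0, T] -> z t = w t i 0.
  by move=> i; have [z cz zE] := continuous_extension T0 (cw i); exists z.
exists (fun t => \col_i z i t) => [i|t tT].
  have -> : (fun t => (\col_i0 z i0 t) i 0) = z i by apply/funext => t; rewrite mxE.
  by have [] := zP i.
by apply/colP => i; rewrite mxE; have [_ ->] := zP i.
Qed.

Lemma ae_eq_test_Rintegral T phi (c d : R -> R) : test_function T phi ->
  @bochner_L2 R R^o T c -> @bochner_L2 R R^o T d ->
  {ae mu, forall t, t \in `]0, T[ -> c t = d t} ->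
  \int[mu]_(t in `]0, T[) (phi t * c t) = \int[mu]_(t in `]0, T[) (phi t * d t).
Proof.
move=> tphi c2 d2 cd; congr fine; apply: ae_eq_integral => //.
- by have [/integrableP[]] := test_integrable tphi c2.
- by have [/integrableP[]] := test_integrable tphi d2.
- have FF := ae_filter_ringOfSetsType mu.
  by apply: filterS cd => t h /h ->.
Qed.

(** A weak solution is classical, by the lemma of du Bois-Reymond, and then
[expm N (- t) *m beta t] is constant. *)
Lemma weak_linear_ode_unique p T (N : 'M[R]_p) (beta beta' : R -> 'cV[R]_p) :
  0 < T -> col_H1 T beta beta' ->
  {ae mu, forall t, t \in `]0, T[ -> beta' t = N *m beta t} ->
  beta 0 = 0 -> forall t, t \in `[0, T] -> beta t = 0.
Proof.
move=> T0 hb bN b0.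
have cb i : {within `[0, T], continuous (fun t => beta t i 0)} by case: (hb i).
have [b cb' bE] := col_continuous_extension T0 cb.
have cNb := @continuous_mulmx _ _ N _ cb'.
have /choice[W WP] : forall i, exists W : R -> R, W 0 = 0 /\
    forall t : R, is_derive t (1 : R) W ((N *m b t) i 0).
  by move=> i; have [W W0 dW] := continuous_antiderivative (cNb i); exists W.
have betaW t i : t \in `[0, T] -> beta t i 0 = W i t.
  move=> tT; have [W0 dW] := WP i.
  have := @du_bois_reymond R T (fun t => beta t i 0) _ (W i) T0 (cb i) (cNb i) dW.
  move=> /(_ _ t tT); rewrite b0 W0 mxE subrr => h.
  apply/eqP; rewrite -subr_eq0; apply/eqP/h => phi tphi.
  rewrite (H1_scalarW (hb i) tphi); congr (- _).
  apply: (ae_eq_test_Rintegral tphi); first by case: (hb i) => _ _ _ [].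
    by apply: continuous_bochner_L2; exact: continuous_subspaceT.
  have FF := ae_filter_ringOfSetsType mu.
  apply: filterS bN => s bs sT; rewrite bs// bE//.
  exact: subset_itv_oo_cc.
pose Z t : 'cV[R]_p := \col_i W i t.
have dZ t : mx_is_derive Z t (N *m b t).
  move=> i j; rewrite ord1.
  have -> : (fun s => Z s i 0) = W i by apply/funext => s; rewrite mxE.
  by have [_] := WP i.
have bZ t : t \in `[0, T] -> beta t = Z t.
  by move=> tT; apply/colP => i; rewrite mxE betaW.
pose z t := expm N (- t) *m Z t.
have dz t : mx_is_derive z t (expm N (- t) *m (N *m (b t - Z t))).
  have := mx_is_deriveM (mx_is_derive_opp (expm_derive N (- t))) (dZ t).
  by rewrite -expm_comm addrC mulNmx -mulmxA -mulmxBr -mulmxBr.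
have z0 t : t \in `[0, T] -> z t = 0.
  move=> tT; move: (tT); rewrite in_itv/= => /andP[t0 _].
  apply/colP => i; rewrite [RHS]mxE.
  have -> : 0 = z 0 i 0 by rewrite /z -bZ ?b0 ?mulmx0 ?mxE// in_itv/= lexx ltW.
  have dzi s : s \in `]0, T[ -> derivable (fun s => z s i 0) s 1.
    by move=> _; have [] := dz s i 0.
  have dzE s : s \in `]0, T[ -> derive1 (fun s => z s i 0) s = 0.
    move=> /subset_itv_oo_cc sT; rewrite derive1E; have [_ ->] := dz s i 0.
    by rewrite bE// bZ// subrr !mulmx0 mxE.
  have cz : {within `[0, T], continuous (fun s => z s i 0)}.
    by apply: continuous_subspaceT; exact: is_derive_continuous (fun s => dz s i 0).
  have zT : 0 \in `[0, T] by rewrite in_itv/= lexx ltW.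
  apply/eqP; rewrite eq_le; apply/andP; split.
  - apply: (ler0_derive1_le_cc dzi _ cz tT zT t0).
    by move=> s /dzE ->.
  - apply: (ger0_derive1_le_cc dzi _ cz zT tT t0).
    by move=> s /dzE ->.
move=> t tT; rewrite bZ//.
by rewrite -[Z t]mul1mx -(expmN N t) -mulmxA -/(z t) z0// mulmx0.
Qed.

Section SaddlePointSystem.
Context {n m : nat} (A : 'M[R]_n) (K : 'M[R]_m) (B : 'M[R]_(m, n)).
Context (dA : definite_mx A) (B0 : forall y : 'cV[R]_m, B^T *m y = 0 -> y = 0).

Let S := B *m invmx A *m B^T.

(** Let [D] be the primitive of [d]. Eliminating [c] from the second equation,
integrated in time, leaves [S D' + K D = B c0 + P - B A^-1 F], where [P] is the
primitive of [G]: a linear differential equation for [D] whose right-hand side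
is continuous, although [G] is only square integrable. Multiplied by [S^-1], that
side is called [W]. *)
Lemma saddle_point_system_solution T (F F' : R -> 'cV[R]_n) (G : R -> 'cV[R]_m)
    (c0 : 'cV[R]_n) (d0 : 'cV[R]_m) :
  0 < T -> col_H1 T F F' ->
  (forall i, @bochner_L2 R R^o T (fun t => G t i 0)) ->
  A *m c0 - B^T *m d0 = F 0 ->
  exists c c' d d', [/\ col_H1 T c c', col_H1 T d d', c 0 = c0, d 0 = d0 &
    (forall t, A *m c t - B^T *m d t = F t) /\
    (forall t, t \in `]0, T[ -> B *m c' t + K *m d t = G t)].
Proof.
move=> T0 hF G2 init.
have uA := definite_mx_unit dA.
have uS : S \in unitmx := definite_mx_unit (definite_mx_schur dA B0).
have /choice[P0 P0P] : forall i, exists P : R -> R, P 0 = 0 /\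
    @H1_with_derivative R R^o T setT P (fun t => G t i 0).
  move=> i; have [P [Pz cP wP]] :=
    integrable_primitive T0 (bochner_L2_integrable (G2 i)).
  by exists P; split => //; exact: H1_scalarI.
pose P t : 'cV[R]_m := \col_i P0 i t.
have hP : col_H1 T P G.
  move=> i; have -> : (fun t => P t i 0) = P0 i by apply/funext => t; rewrite mxE.
  by have [] := P0P i.
pose BA := B *m invmx A.
pose W t := invmx S *m (B *m c0 + P t + (- BA) *m F t).
have hW : col_H1 T W (fun t => invmx S *m (0 + G t + (- BA) *m F' t)).
  apply/col_H1_mul/col_H1D; last exact: col_H1_mul.
  by apply: col_H1D => //; exact: col_H1_cst.
have cW i : {within `[0, T], continuous (fun t => W t i 0)} by case: (hW i).
have [w cw wE] := col_continuous_extension T0 cW.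
pose M := - (invmx S *m K).
have [D D0 dD] := linear_ode_solution M cw.
(* [d = D'] on [[0, T]], where [w] and [W] agree; this form shows the weak
derivative [d']. *)
pose d t := M *m D t + W t.
have dDE t : t \in `[0, T] -> M *m D t + w t = d t by move=> tT; rewrite wE.
have cD i := is_derive_continuous (fun t => dD t i 0).
have hD : col_H1 T D (fun t => M *m D t + w t).
  apply: col_H1_classical => // i t.
  have -> : (fun t => (M *m D t + w t) i 0) = (fun t => (M *m D t) i 0 + w t i 0).
    by apply/funext => s; rewrite mxE.
  by apply: cvgD; [exact: continuous_mulmx|exact: cw].
pose d' t := M *m (M *m D t + w t) + invmx S *m (0 + G t + (- BA) *m F' t).
have hd : col_H1 T d d' by apply: col_H1D => //; exact: col_H1_mul.
pose c t := invmx A *m (F t + B^T *m d t).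
pose c' t := invmx A *m (F' t + B^T *m d' t).
have hc : col_H1 T c c' by apply/col_H1_mul/col_H1D => //; exact: col_H1_mul.
have P0z : P 0 = 0 by apply/colP => i; rewrite !mxE; have [] := P0P i.
have Ac0 : A *m c0 = F 0 + B^T *m d0 by rewrite -init subrK.
have c0E : c0 = invmx A *m (F 0 + B^T *m d0) by rewrite -Ac0 mulmxA mulVmx// mul1mx.
have d0E : d 0 = d0.
  rewrite /d D0 mulmx0 add0r /W P0z addr0 {1}c0E mulNmx !mulmxDr -!mulmxA.
  have -> : B *m (invmx A *m (B^T *m d0)) = S *m d0 by rewrite /S !mulmxA.
  by rewrite mulKmx// mulmxN addrAC subrr add0r.
exists c, c', d, d'; split => //.
- by rewrite /c d0E c0E.
- split=> t; first by rewrite /c mulmxA mulmxV// mul1mx addrK.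
  move=> /subset_itv_oo_cc tT.
  have BAd : B *m c' t = BA *m F' t + S *m d' t.
    by rewrite /c' /BA /S mulmxDr !mulmxA !mulmxDr !mulmxA.
  rewrite BAd /d' dDE// mulmxDr !(mulmxA S) mulmxV// mul1mx.
  have -> : S *m M = - K by rewrite /M mulmxN mulKVmx.
  rewrite !mulNmx add0r addrCA [G t - _]addrC addNKr.
  by rewrite addrAC addNr add0r.
Qed.

End SaddlePointSystem.
End ColumnH1.

(** * The semidiscrete problem *)

Section Semidiscrete.
Context {R : realType} {V Q Q0 : normedModType R} (emb : {linear Q -> Q0}).
Notation mu := (@lebesgue_measure R).
Context (a : {bilinear V -> V -> R | *%R & *%R}).
Context (k : {bilinear Q -> Q -> R | *%R & *%R}).
Context (b : {bilinear V -> Q0 -> R | *%R & *%R}).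
Context (n m : nat) (phi : 'I_n -> V) (psi : 'I_m -> Q).
Context (Vh : set V) (Qh : set Q).
Context (basis_phi : is_basis Vh phi) (basis_psi : is_basis Qh psi).
Context (A1 : bounded_elliptic_symmetric a) (A2 : bounded_elliptic_symmetric k).
Context (b_bounded : bounded_form a b).
Context (normQ0 : forall q : Q, `|emb q| <= energy_norm k q).
Context (T : R) (T0 : 0 < T) (f : R -> dual V) (g : R -> dual Q).

Local Notation A := (a_matrix a phi).
Local Notation K := (k_matrix k psi).
Local Notation B := (b_matrix emb b phi psi).

Lemma dual_eval_bounded {X : normedModType R} (x : X) :
  @bounded_linear R (dual X) R^o (fun l => l x).
Proof.
split=> //; exists `|x| => l.
have [->|x0] := eqVneq x 0.
  have := dual_lincomb (fun i : 'I_0 => 0) l 0.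
  by rewrite lincomb0 big_ord0 => ->; rewrite !normr0 mul0r.
have nx0 : 0 < `|x| by rewrite normr_gt0.
have -> : l x = `|x| * l (`|x|^-1 *: x).
  have lZ r : l (r *: x) = r * l x.
    have := dual_lincomb (fun i : 'I_1 => x) l (const_mx r).
    by rewrite /lincomb !big_ord_recl !big_ord0 !addr0 mxE.
  by rewrite lZ mulrA mulfV ?mul1r// gt_eqF.
rewrite normrM normr_id ler_wpM2l//; apply: dual_norm_ub.
by rewrite normrZ normfV normr_id mulVf// gt_eqF.
Qed.

Lemma semidiscrete_exists df (u0 : V) (p0 : Q) :
  (forall y : 'cV[R]_m, B^T *m y = 0 -> y = 0) ->
  H1_with_derivative T setT f df -> bochner_L2 T g ->
  Vh u0 -> Qh p0 -> first_equation emb a b Vh u0 p0 (f 0) ->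
  exists u p,
    [/\ semidiscrete_solution emb a k b T Vh Qh f g u p, u 0 = u0 & p 0 = p0].
Proof.
move=> B0 hf hg /(lincombP basis_phi)[c0 ->] /(lincombP basis_psi)[d0 ->].
move=> /(first_equationE _ _ _ _ basis_phi) init.
pose F t : 'cV[R]_n := \col_i f t (phi i).
pose F' t : 'cV[R]_n := \col_i df t (phi i).
pose G t : 'cV[R]_m := \col_i g t (psi i).
have hF : col_H1 T F F'.
  move=> i; have -> : (fun t => F t i 0) = (fun l : dual V => l (phi i)) \o f.
    by apply/funext => t; rewrite mxE.
  have -> : (fun t => F' t i 0) = (fun l : dual V => l (phi i)) \o df.
    by apply/funext => t; rewrite mxE.
  exact: H1_comp (dual_eval_bounded (phi i)) _ hf.
have G2 i : @bochner_L2 R R^o T (fun t => G t i 0).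
  have -> : (fun t => G t i 0) = (fun l : dual Q => l (psi i)) \o g.
    by apply/funext => t; rewrite mxE.
  exact: bochner_L2_comp (dual_eval_bounded (psi i)) hg.
have [c [c' [d [d' [hc hd c0E d0E [eq1 eq2]]]]]] :=
  saddle_point_system_solution K (a_matrix_definite basis_phi A1) B0 T0 hF G2 init.
exists (fun t => lincomb phi (c t)), (fun t => lincomb psi (d t)).
rewrite c0E d0E; split=> //.
exists (fun t => lincomb phi (c' t)), (fun t => lincomb psi (d' t)); split.
- exact: H1_lincomb.
- exact: H1_lincomb.
- apply: aeW => t tT; split; first exact/(first_equationE _ _ _ _ basis_phi)/eq1.
  exact/(second_equationE _ _ _ basis_psi _ _ erefl)/(eq2 t tT).
Qed.

Lemma continuous_comp_bounded {X : normedModType R} (l : X -> R^o) (S : set X)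
    w dw :
  bounded_linear l -> H1_with_derivative T S w dw ->
  {within `[0, T], continuous (fun t => l (w t) : R)}.
Proof. by move=> bl /(H1_comp bl (S' := setT) (fun _ _ => I))[]. Qed.

(** [b (u t) (emb (psi i))] satisfies, for the difference [u] of two solutions, a
homogeneous linear differential equation in the weak sense. *)
Lemma semidiscrete_unique u1 p1 u2 p2 :
  (forall y : 'cV[R]_m, B^T *m y = 0 -> y = 0) ->
  semidiscrete_solution emb a k b T Vh Qh f g u1 p1 ->
  semidiscrete_solution emb a k b T Vh Qh f g u2 p2 ->
  u1 0 = u2 0 -> forall t, t \in `[0, T] -> u1 t = u2 t /\ p1 t = p2 t.
Proof.
move=> B0 [du1 [dp1 [hu1 hp1 eq1]]] [du2 [dp2 [hu2 hp2 eq2]]] u120.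
pose u t := u1 t - u2 t; pose du t := du1 t - du2 t.
pose p t := p1 t - p2 t.
have hu : H1_with_derivative T Vh u du := H1B basis_phi hu1 hu2.
have hp := H1B basis_psi hp1 hp2; rewrite -/p in hp.
have FF := ae_filter_ringOfSetsType mu.
have eqh : {ae mu, forall t, t \in `]0, T[ ->
    (forall i, a (u t) (phi i) = b (phi i) (emb (p t))) /\
    (forall i, b (du t) (emb (psi i)) = - k (p t) (psi i))}.
  apply: filterS2 eq1 eq2 => t e1 e2 tT.
  have [[e11 e12] [e21 e22]] := (e1 tT, e2 tT).
  split=> i.
  - have vi := basis_in basis_phi i.
    have := e11 _ vi; rewrite -(e21 _ vi) /u /p.
    rewrite linearB linearBl linearBr /= => /(canRL (subrK _)) ->; ring.
  - have qi := basis_in basis_psi i.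
    have := e12 _ qi; rewrite -(e22 _ qi) /du /p.
    rewrite !linearBl /= => /(canRL (addrK _)) ->; ring.
pose beta t : 'cV[R]_m := \col_i b (u t) (emb (psi i)).
pose beta' t : 'cV[R]_m := \col_i b (du t) (emb (psi i)).
have hbeta : col_H1 T beta beta'.
  move=> i; have bl := form_b_boundedl A1 b_bounded (emb (psi i)).
  have -> : (fun t => beta t i 0) = (fun v => b v (emb (psi i))) \o u.
    by apply/funext => t; rewrite mxE.
  have -> : (fun t => beta' t i 0) = (fun v => b v (emb (psi i))) \o du.
    by apply/funext => t; rewrite mxE.
  exact: H1_comp bl _ hu.
(* Both sides are continuous, so that the equation holds at every time. *)
have first_eq t : t \in `[0, T] ->
    forall i, a (u t) (phi i) = b (phi i) (emb (p t)).
  move=> tT i; apply: (@continuous_ae_eq R 0 T (fun t => a (u t) (phi i))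
    (fun t => b (phi i) (emb (p t)))) => //.
  - by have := continuous_comp_bounded (form_boundedl (phi i) A1) hu.
  - by have := continuous_comp_bounded
      (form_b_emb_boundedr A2 b_bounded normQ0 (phi i)) hp.
  - by apply: filterS eqh => s h /h[->].
have uA := definite_mx_unit (a_matrix_definite basis_phi A1).
pose S := B *m invmx A *m B^T.
have uS : S \in unitmx.
  exact: definite_mx_unit (definite_mx_schur (a_matrix_definite basis_phi A1) B0).
have coord t : t \in `[0, T] -> exists x y,
    [/\ u t = lincomb phi x, p t = lincomb psi y, x = invmx A *m (B^T *m y) &
        beta t = S *m y].
  move=> tT; case: hu hp => _ /(_ t tT)/(lincombP basis_phi)[x ux] _ _ _.
  move=> [_ /(_ t tT)/(lincombP basis_psi)[y py] _ _ _].
  have Ax : A *m x = B^T *m y.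
    by apply/colP => i; rewrite a_matrixE b_matrix_trE -ux -py first_eq.
  have xE : x = invmx A *m (B^T *m y) by rewrite -Ax mulKmx.
  exists x, y; split=> //.
  rewrite /S -!mulmxA -xE; apply/colP => i.
  by rewrite b_matrixE mxE ux.
have beta_ae : {ae mu, forall t, t \in `]0, T[ ->
    beta' t = - (K *m invmx S) *m beta t}.
  apply: filterS eqh => t h tT; have [_ e2] := h tT.
  have [x [y [_ py _ ->]]] := coord t (subset_itv_oo_cc tT).
  rewrite mulNmx -mulmxA mulKmx//; apply/colP => i.
  by rewrite !mxE e2 py -k_matrixE !mxE.
have beta0 : beta 0 = 0.
  by apply/colP => i; rewrite !mxE /u u120 subrr linear0l.
move=> t tT; have [x [y [ut pt xE]]] := coord t tT.
rewrite (weak_linear_ode_unique T0 hbeta beta_ae beta0 tT) => /esym Sy.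
have y0 : y = 0 by rewrite -[y](mulKmx uS) Sy mulmx0.
have {}pt : p t = 0 by rewrite pt y0 lincomb0.
have {}ut : u t = 0 by rewrite ut xE y0 !mulmx0 lincomb0.
by split; apply/eqP; rewrite -subr_eq0; apply/eqP.
Qed.

(** Testing the second equation with a [q] that [b] does not see leaves
[k (p t) q = g t q], so that [k (p 0) q] is determined by [g], whereas the
first equation at time zero is insensitive to multiples of [q] in [p 0]. *)
Lemma semidiscrete_incompatible (y : 'cV[R]_m) : y != 0 -> B^T *m y = 0 ->
  exists u0 p0, [/\ Vh u0, Qh p0, first_equation emb a b Vh u0 p0 (f 0) &
    ~ exists u p, [/\ semidiscrete_solution emb a k b T Vh Qh f g u p,
                      u 0 = u0 & p 0 = p0]].
Proof.
move=> y0 By; apply: contrapT => H.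
have sol u0 p0 : Vh u0 -> Qh p0 -> first_equation emb a b Vh u0 p0 (f 0) ->
    exists u p,
      [/\ semidiscrete_solution emb a k b T Vh Qh f g u p, u 0 = u0 & p 0 = p0].
  by move=> Vu Qp eq0; apply: contrapT => nsol; apply: H; exists u0, p0.
have uA := definite_mx_unit (a_matrix_definite basis_phi A1).
pose c0 := invmx A *m \col_i f 0 (phi i).
have init z : B^T *m z = 0 ->
    first_equation emb a b Vh (lincomb phi c0) (lincomb psi z) (f 0).
  move=> Bz; apply/(first_equationE _ _ _ _ basis_phi).
  by rewrite Bz subr0 /c0 mulKVmx.
pose q := lincomb psi y.
have bq v : Vh v -> b v (emb q) = 0.
  move=> /(lincombP basis_phi)[c ->].
  by rewrite -b_matrix_quad -dot_mulmx By mulmx0 mxE.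
have Qq : Qh q := lincomb_in basis_psi y.
have [u1 [p1 [[du1 [dp1 [hu1 hp1 eq1]]] _ p10]]] :=
  sol _ _ (lincomb_in basis_phi c0) (lincomb_in basis_psi 0) (init 0 (mulmx0 _ _)).
have [u2 [p2 [[du2 [dp2 [hu2 hp2 eq2]]] _ p20]]] :=
  sol _ _ (lincomb_in basis_phi c0) Qq (init y By).
have FF := ae_filter_ringOfSetsType mu.
have kpq : {ae mu, forall t, t \in `]0, T[ -> k (p1 t) q = k (p2 t) q}.
  apply: filterS2 eq1 eq2 => t e1 e2 tT.
  have [[_ e12] [_ e22]] := (e1 tT, e2 tT).
  have := e12 _ Qq; rewrite -(e22 _ Qq).
  case: hu1 hu2 => _ _ Vdu1 _ _ [_ _ Vdu2 _ _].
  by rewrite !bq ?add0r//; [exact: Vdu2|exact: Vdu1].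
have bl := form_boundedl q A2.
have z0T : 0 \in `[0, T] by rewrite in_itv/= lexx ltW.
have := continuous_ae_eq T0 (continuous_comp_bounded bl hp1)
  (continuous_comp_bounded bl hp2) kpq z0T.
rewrite p10 p20 lincomb0 linear0l => /esym kqq.
move/eqP: y0; apply; apply: (lincomb_inj0 basis_psi).
by apply: (elliptic_definite A2); rewrite -/q kqq.
Qed.

End Semidiscrete.

Theorem theorem8 (R : realType) (V Q Q0 : completeNormedModType R)
  (hilbert_V : hilbert V) (hilbert_Q : hilbert Q) (hilbert_Q0 : hilbert Q0)
  (emb : {linear Q -> Q0}) (embQ : compact_dense_embedding emb)
  (a : {bilinear V -> V -> R | *%R & *%R})
  (k : {bilinear Q -> Q -> R | *%R & *%R})
  (b : {bilinear V -> Q0 -> R | *%R & *%R})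
  (A1 : bounded_elliptic_symmetric a)
  (A2 : bounded_elliptic_symmetric k)
  (A3 : bounded_form a b /\ infsup_stable a b setT setT)
  (normQ0 : forall q : Q, `|emb q| <= energy_norm k q)
  (T : R) (T_gt0 : 0 < T) (f : R -> dual V) (g : R -> dual Q)
  (fH1 : exists df, H1_with_derivative T setT f df)
  (gL2 : bochner_L2 T g)
  (Vh : set V) (Qh : set Q)
  (Vh_fin : fin_dim_subspace Vh) (Qh_fin : fin_dim_subspace Qh) :
  [/\
    (* regular DAE of index 1, in any choice of bases; the index claim is
       void for the empty system Vh = 0, Qh = 0 *)
    forall (n m : nat) (phi : 'I_n -> V) (psi : 'I_m -> Q),
      is_basis Vh phi -> is_basis Qh psi ->
      regular_pencil (dae_E emb b phi psi) (dae_F emb a k b phi psi) /\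
      ((0 < n + m)%N ->
        differentiation_index (dae_E emb b phi psi)
                              (dae_F emb a k b phi psi) 1),
    infsup_stable a b Vh (emb @` Qh) ->
      forall (u0 : V) (p0 : Q), Vh u0 -> Qh p0 ->
      first_equation emb a b Vh u0 p0 (f 0) ->
      exists (u : R -> V) (p : R -> Q),
        [/\ semidiscrete_solution emb a k b T Vh Qh f g u p,
            u 0 = u0, p 0 = p0 &
            forall (u' : R -> V) (p' : R -> Q),
              semidiscrete_solution emb a k b T Vh Qh f g u' p' ->
              u' 0 = u0 -> p' 0 = p0 ->
              forall t, t \in `[0, T] -> u' t = u t /\ p' t = p t] &
    ~ infsup_stable a b Vh (emb @` Qh) ->
      exists (u0 : V) (p0 : Q),
        [/\ Vh u0, Qh p0, first_equation emb a b Vh u0 p0 (f 0) &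
            ~ exists (u : R -> V) (p : R -> Q),
                [/\ semidiscrete_solution emb a k b T Vh Qh f g u p,
                    u 0 = u0 & p 0 = p0]]].
Proof.
have [emb_inj _ _] := embQ; have [b_bounded _] := A3; have [df hf] := fH1.
have [n [phi basis_phi]] := Vh_fin; have [m [psi basis_psi]] := Qh_fin.
split.
- move=> n' m' phi' psi' basis_phi' basis_psi'.
  have dA := a_matrix_definite basis_phi' A1.
  have dK := k_matrix_definite basis_psi' A2.
  by split; [exact: saddle_point_regular|exact: saddle_point_index1].
- move=> /(infsup_stable_ker0 basis_phi basis_psi emb_inj) B0 u0 p0 Vu0 Qp0 init.
  have [u [p [sol u0E p0E]]] :=
    semidiscrete_exists k basis_phi basis_psi A1 T_gt0 B0 hf gL2 Vu0 Qp0 init.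
  exists u, p; split=> // u' p' sol' u'0 _.
  apply: (semidiscrete_unique basis_phi basis_psi A1 A2 b_bounded normQ0 T_gt0
    B0 sol' sol).
  by rewrite u'0 u0E.
- move=> not_stable.
  have [y y0 By] : exists2 y : 'cV[R]_m, y != 0 &
      (b_matrix emb b phi psi)^T *m y = 0.
    apply: contrapT => no_y; apply: not_stable.
    apply: (ker0_infsup_stable basis_phi basis_psi A1 b_bounded normQ0) => y By.
    by apply: contrapT => /eqP y0; apply: no_y; exists y.
  exact (semidiscrete_incompatible basis_phi basis_psi A1 A2 T_gt0 f g y0 By).
Qed.
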